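(* Let $A$ be a maximal indecomposable cyclotomic matrix over the ring $\mathbb{Z}[\sqrt{3}]$ which is not a matrix over $\mathbb{Z}$. Then $A$ is equivalent to one of the following matrices: $S_2'=\begin{pmatrix}\sqrt3&1\\1&-\sqrt3\end{pmatrix}$, $S_2^\dag=\begin{pmatrix}1&\sqrt3\\ \sqrt3&-1\end{pmatrix}$, or $S_4^{(\sqrt3)}$, the adjacency matrix of the uncharged $4$-cycle on vertices $a,b,d,c$ (in cyclic order) with edges $ab$ and $dc$ of weight $\sqrt3$, $bd$ of weight $1$ and $ca$ of weight $-1$ (all other entries $0$). Moreover, every indecomposable cyclotomic $\mathbb{Z}[\sqrt{3}]$-matrix is contained (as a principal submatrix) in a maximal one.
   Context: A real symmetric matrix $A$ is cyclotomic if its characteristic polynomial $\det(xI-A)$ has integer coefficients and all its eigenvalues lie in $[-2,2]$. A square matrix is indecomposable if it is not equivalent (in the sense below) to a block diagonal matrix with more than one block, equivalently its underlying graph (vertices $u\neq v$ adjacent iff $a_{uv}\ne0$) is connected. A maximal indecomposable cyclotomic matrix over a ring $T$ is an indecomposable cyclotomic $T$-matrix that is not a proper principal submatrix of any indecomposable cyclotomic $T$-matrix. Equivalence: with $K=\mathbb{Q}(\sqrt3)$, $A$ is strongly equivalent to $B$ if $A=\sigma(QBQ^\top)$ for some $Q\in O_n(\mathbb{Z})$ (signed permutation matrix) and some $\sigma\in\operatorname{Gal}(K/\mathbb{Q})$ applied entrywise; $A$ and $B$ are equivalent if $A$ is strongly equivalent to $B$ or to $-B$. The adjacency matrix of a weighted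 graph has $(u,v)$ entry the weight of edge $uv$ (zero if absent) and diagonal entries the vertex charges (here all $0$). *)

(* Defs.v *)
From HB Require Import structures.
From mathcomp Require Import all_boot all_order all_algebra all_field.
Set Implicit Arguments. Unset Strict Implicit. Unset Printing Implicit Defensive.
Import Order.TTheory GRing.Theory Num.Theory.
Local Open Scope ring_scope.

Definition s3 : algC := sqrtC 3%:R.

Definition inZs3 (x : algC) : Prop := exists a b : int, x = a%:~R + b%:~R * s3.
Definition inZ (x : algC) : Prop := exists a : int, x = a%:~R.

Definition Zs3_mx n (A : 'M[algC]_n) : Prop := forall i j, inZs3 (A i j).
Definition Z_mx n (A : 'M[algC]_n) : Prop := forall i j, inZ (A i j).

Definition cyclotomic n (A : 'M[algC]_n) : Prop :=
  [/\ forall i j, A i j \is Num.real,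
      A^T = A,
      forall k, (char_poly A)`_k \is a Num.int
    & forall z, eigenvalue A z -> -2 <= z <= 2].

Definition adj_rel n (A : 'M[algC]_n) : rel 'I_n :=
  fun i j => (i != j) && (A i j != 0).
Definition indecomposable n (A : 'M[algC]_n) : Prop :=
  forall i j : 'I_n, connect (adj_rel A) i j.

Definition principal_sub n m (A : 'M[algC]_n) (B : 'M[algC]_m) : Prop :=
  exists f : 'I_n -> 'I_m, injective f /\ forall i j, A i j = B (f i) (f j).

Definition indec_cyc_Zs3 n (A : 'M[algC]_n) : Prop :=
  [/\ Zs3_mx A, indecomposable A & cyclotomic A].

Definition maximal_indec_cyc_Zs3 n (A : 'M[algC]_n) : Prop :=
  indec_cyc_Zs3 A /\
  ~ (exists m (B : 'M[algC]_m), (n < m)%N /\ indec_cyc_Zs3 B /\ principal_sub A B).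

(* signed permutation matrices (= O_n(Z)); a bijection 'I_n -> 'I_m forces n = m *)
Definition signed_perm_mx n m (Q : 'M[algC]_(n, m)) : Prop :=
  exists (p : 'I_n -> 'I_m) (s : 'I_n -> bool), bijective p /\
    Q = \matrix_(i, j) (if p i == j then (-1) ^+ s i else 0).

(* y = sigma_s(x) for the element sigma_s of Gal(Q(sqrt3)/Q): identity if s = false,
   sqrt3 |-> -sqrt3 if s = true *)
Definition gal_rel (s : bool) (x y : algC) : Prop :=
  exists a b : rat, x = ratr a + ratr b * s3 /\ y = ratr a + (-1) ^+ s * ratr b * s3.

Definition strongly_equiv n m (A : 'M[algC]_n) (B : 'M[algC]_m) : Prop :=
  exists (Q : 'M[algC]_(n, m)) (s : bool), signed_perm_mx Q /\
    forall i j, gal_rel s ((Q *m B *m Q^T) i j) (A i j).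

Definition equiv_mx n m (A : 'M[algC]_n) (B : 'M[algC]_m) : Prop :=
  strongly_equiv A B \/ strongly_equiv A (- B).

Definition tbl m n (i : 'I_m) (j : 'I_n) (t : seq (seq algC)) : algC :=
  nth 0 (nth [::] t i) j.


Definition S2' : 'M[algC]_2 :=
  \matrix_(i, j) tbl i j [:: [:: s3; 1]; [:: 1; - s3]].
Definition S2dag : 'M[algC]_2 :=
  \matrix_(i, j) tbl i j [:: [:: 1; s3]; [:: s3; -1]].
(* vertices indexed a = 0, b = 1, c = 2, d = 3; 4-cycle a-b-d-c-a with
   w(ab) = w(dc) = sqrt3, w(bd) = 1, w(ca) = -1 *)
Definition S4s3 : 'M[algC]_4 :=
  \matrix_(i, j) tbl i j [:: [:: 0; s3; -1; 0];
                             [:: s3; 0; 0; 1];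
                             [:: -1; 0; 0; s3];
                             [:: 0; 1; s3; 0]].

(* Main.v *)
(* Part 1. Cyclotomicity of A and of its conjugate under sqrt 3 |-> - sqrt 3 bounds every row by
   sum (x^2 + 3 y^2) <= 4 for entries x + y sqrt 3, and a row with equality is orthogonal to all
   the other rows, since 4 - A^2 is positive semidefinite.  Around an entry +-sqrt 3 this leaves no
   freedom: A is, up to signs, a principal submatrix of S2', S2dag or S4, whose squares are 4.
   A matrix of square 4 is maximal, because all of its rows are full.

   Part 2. If A lies in no maximal matrix, then it has arbitrarily large extensions, and these are
   integral by part 1.  A large connected signed charged graph contains a long induced path.
   Writing the path vertices as e_i - e_(i+1), every other vertex of a graph with a longest such
   path must be a twin e_i + e_(i+1) of a path vertex, possibly after closing the path to a cycle
   and with charges +-1 allowed at the two ends: everything else is excluded by an integer vector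
   on which 2 + A or 2 - A is negative, inside a window of bounded size.  Hence the large extension
   embeds into one of two explicit families of integer matrices of square 4. *)

From Stdlib Require Import ZArith Classical.
From HB Require Import structures.
From mathcomp Require Import all_boot all_order all_algebra all_field.
From mathcomp Require Import zify ring ssrZ.
Require Import Defs.
Set Implicit Arguments. Unset Strict Implicit. Unset Printing Implicit Defensive.
Import Order.TTheory GRing.Theory Num.Theory.
Local Open Scope ring_scope.

(** * Integral quadratic forms that are not positive semidefinite *)

(** The small maximal integer matrices are never classified: a chain of proper extensions without a
    maximal member passes every size, so it is enough to complete the large ones. Geometrically, the
    path vertices e_i - e_(i+1) have Gram matrix 2 - A, and a charge l at the left end means that
    e_0 has squared length 1 - l. A charge therefore lengthens a vector in one of the forms 2 + A, 2
    - A and shortens it in the other, which is why both are tested. Products with a long stretch of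
    the path almost determine a further vector, and integrality of the entries does the rest; this
    rigidity makes windows of at most 16 vertices sufficient. Whatever such a window excludes is
    established by evaluating the form at one integer vector. What is left is to slide windows along
    the path so that they see at most its left end, the right end being reached by reversal, and to
    carry them across the seam of a cycle. The path itself is a geodesic, which is long because
    degrees are at most 4. *)

Definition dotZ (x y : seq Z) : Z :=
  foldr Z.add Z0 [seq Z.mul p.1 p.2 | p <- zip x y].

Definition formZ (M : seq (seq Z)) (y : seq Z) : Z := dotZ y [seq dotZ y r | r <- M].

Definition axpyZ (a : Z) (x : seq Z) (b : Z) (y : seq Z) : seq Z :=
  [seq Z.add (Z.mul a p.1) (Z.mul b p.2) | p <- zip x y].

(** Keeps the coefficients small during the orthogonalization; a positive rescaling does not change
    the sign of the form. *)
Definition primitiveZ (x : seq Z) : seq Z :=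
  let g := foldr Z.gcd Z0 x in [seq Z.div a g | a <- x].

Definition unitZ_row (n i : nat) : seq Z := mkseq (fun j => Z.b2z (i == j)) n.

(* Gram-Schmidt on the standard basis.  Nothing is proved about this search: only the value of the
   form at the vector it returns matters. *)
Fixpoint negative_vector_rec (M : seq (seq Z)) (n : nat)
    (basis : seq (seq Z * seq Z * Z)) (todo : seq nat) : seq Z :=
  if todo isn't i :: todo' then [::] else
  let u := foldl (fun u t =>
      let a := dotZ u t.1.2 in
      if Z.eqb a Z0 then u else primitiveZ (axpyZ t.2 u (Z.opp a) t.1.1))
    (unitZ_row n i) basis in
  let Mu := [seq dotZ u r | r <- M] in
  match dotZ u Mu with
  | Zneg _ => u
  | Zpos q => negative_vector_rec M n (rcons basis (u, Mu, Zpos q)) todo'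
  | Z0 =>
    (* Here u is isotropic. If [(M u)_k] is nonzero, the form at [t u + e_k] is
       [2 t (M u)_k + M_kk], and the chosen t makes it at most [- M_kk - 2]. If [M u] vanishes, u
       lies in the radical and is dropped. *)
    let k := find (fun a => ~~ Z.eqb a Z0) Mu in
    if (k < n)%N then
      axpyZ (Z.opp (Z.mul (Z.add (nth Z0 (nth [::] M k) k) (Zpos 1)) (nth Z0 Mu k))) u
            (Zpos 1) (unitZ_row n k)
    else negative_vector_rec M n basis todo'
  end.

Definition negative_vector (M : seq (seq Z)) : seq Z :=
  negative_vector_rec M (size M) [::] (iota 0 (size M)).

Definition has_negative (M : seq (seq Z)) : bool :=
  Z.ltb (formZ M (negative_vector M)) Z0.

Definition shifted_gram (e : Z) (n : nat) (c : nat -> nat -> Z) : seq (seq Z) :=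
  mkseq (fun i => mkseq (fun j => Z.add (if i == j then Zpos 2 else Z0) (Z.mul e (c i j))) n) n.

(* Conditionals rather than boolean connectives, here and below, because vm_compute evaluates both
   arguments of a connective. *)
Definition forbidden (n : nat) (c : nat -> nat -> Z) : bool :=
  if has_negative (shifted_gram (Zpos 1) n c) then true else has_negative (shifted_gram (Zneg 1) n c).

(* A path whose first vertex carries the charge l. *)
Definition pathZ (l : Z) (i j : nat) : Z :=
  if j == i.+1 then (Zpos 1) else if i == j.+1 then (Zpos 1) else
  if (i == 0) && (j == 0) then l else Z0.

Definition bordered (n : nat) (c : nat -> nat -> Z) (x : seq Z) (d : Z) (i j : nat) : Z :=
  if (i < n)%N then if (j < n)%N then c i j else nth Z0 x i
  else if (j < n)%N then nth Z0 x j else d.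

(* If path vertex j is e_j - e_(j+1), then the twin of vertex i is e_i + e_(i+1); the twin of a
   charged end vertex carries the same charge l and is joined to it with weight l. *)
Definition twin_entry (l : Z) (i j : nat) : Z :=
  if i == j.+1 then Zpos 1 else if j == i.+1 then Zneg 1 else
  if (i == 0) && (j == 0) then l else Z0.
Definition twin_row (l : Z) (n i : nat) : seq Z := mkseq (twin_entry l i) n.
Definition twin_charge (l : Z) (i : nat) : Z := if i == 0 then l else Z0.
Definition twin_adj (l : Z) (i j : nat) : Z :=
  if j == i.+1 then (Zneg 1) else if i == j.+1 then (Zneg 1) else
  if (i == 0) && (j == 0) then l else Z0.

(** * Finite tables of forbidden windows *)

Definition signsZ : seq Z := [:: Z0; (Zpos 1); (Zneg 1)].

(** The test [prune] is applied to every prefix, so that most of the [3 ^ k] sequences are never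
    reached. *)
Fixpoint search (prune good : seq Z -> bool) (k : nat) (x : seq Z) : bool :=
  if prune x then true else
  if k is k'.+1 then all (fun v => search prune good k' (rcons x v)) signsZ else good x.

(* x lists the weights from a vertex of charge d to an initial piece of a path with 11 vertices. *)
Definition attach_prune (l d : Z) (x : seq Z) :=
  if (size x == 6) && all (fun v => Z.eqb v Z0) x then true else
  if ~~ Z.eqb (last Z0 x) Z0 || (size x == 11) then forbidden (size x).+1 (bordered (size x) (pathZ l) x d) else false.

(** The indices stop at 6 because the twin of a later vertex misses the first six path vertices, and
    rows beginning with six zeros are pruned. In the second alternative the weight to the last path
    vertex is left free: the new vertex may close the path to a cycle. *)
Definition attach_good (l d : Z) (x : seq Z) :=
  has (fun i => Z.eqb d (twin_charge l i) &&
     ((x == twin_row l 11 i) || (x == map Z.opp (twin_row l 11 i)))) (iota 0 7)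
  || (Z.eqb l Z0 && all (fun v => Z.eqb v Z0) (take 9 (behead x)) && ~~ Z.eqb (head Z0 x) Z0).


Lemma attach_search :
  all (fun l => all (fun d => search (attach_prune l d) (attach_good l d) 11 [::]) signsZ) signsZ.
Proof. by vm_compute. Qed.

Definition far_cfg (l : Z) (i : nat) (b d : Z) : nat -> nat -> Z :=
  bordered 11 (bordered 10 (pathZ l) (twin_row l 10 i) (twin_charge l i)) (rcons (nseq 10 Z0) b) d.

(** A vertex orthogonal to the path but not to a twin has coordinates of absolute value at least 1/2
    on at least ten basis vectors, hence squared length at least 10/4; in one of the two forms that
    length is at most 2. So whatever misses the path also misses its twins. *)
Lemma far_forbidden :
  all (fun l => all (fun i => all (fun d => all (fun b => forbidden 12 (far_cfg l i b d))
    [:: Zpos 1; Zneg 1]) signsZ) (iota 0 7)) signsZ.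
Proof. by vm_compute. Qed.

Definition pair_cfg (l : Z) (i j : nat) (b : Z) : nat -> nat -> Z :=
  bordered 15 (bordered 14 (pathZ l) (twin_row l 14 i) (twin_charge l i))
    (rcons (twin_row l 14 j) b) (twin_charge l j).

(** On an uncharged path with 14 vertices, the projection of a twin to their span leaves a remainder
    of squared length only 4/15. The product of two twins is thus known up to less than 1, hence
    exactly; for two twins of the same vertex it would be 2, which no admissible weight allows. *)
Lemma pair_forbidden :
  all (fun l => all (fun i => all (fun j => all (fun b =>
     if (i != j) && (b == twin_adj l i j) then true else forbidden 16 (pair_cfg l i j b))
  signsZ) (iota i (12 - i))) (iota 0 5)) signsZ.
Proof. by vm_compute. Qed.

Definition charged_path (ch : seq Z) (i j : nat) : Z :=
  if i == j then nth Z0 ch i else pathZ Z0 i j.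

(** Since [good] is constantly false, success means that every charging of the path with a charged
    centre is forbidden. If the centre alone is charged, the vector (1, 2, 3, 4, 3, 2, 1), with
    alternating signs for the other form, gives 8 - 16. *)
Lemma charged_center_search :
  search (fun ch => if size ch == 7 then
       if nth Z0 ch 3 == Z0 then true else forbidden 7 (charged_path ch) else false)
    (fun=> false) 7 [::].
Proof. by vm_compute. Qed.

Lemma search_sound prune good k x y :
  search prune good k x -> size y = (size x + k)%N -> take (size x) y = x ->
  all (fun v => v \in signsZ) y -> (forall m, ~~ prune (take m y)) -> good y.
Proof.
elim: k x => [|k IHk] x /= Hs szy tk ally np.
  have xy : x = y by rewrite -tk take_oversize // szy addn0.
  by move: Hs; rewrite -{1}tk (negbTE (np _)) xy.
move: Hs; rewrite -{1}tk (negbTE (np _)) => Hs.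
have {}Hs v : v \in signsZ -> search prune good k (rcons x v) 
  by move: v; apply/allP; exact: Hs.
have lt : (size x < size y)%N by rewrite szy; lia.
have Hv : nth Z0 y (size x) \in signsZ by move/allP: ally; apply; apply: mem_nth.
have E : take (size x).+1 y = rcons x (nth Z0 y (size x)) by rewrite (take_nth Z0) // tk.
apply: (IHk _ (Hs _ Hv)) => //; rewrite size_rcons ?szy ?addSnnS //.
Qed.

Lemma dotZ_mkseq (f : nat -> Z) (y : seq Z) n :
  int_of_Z (dotZ y (mkseq f n)) = \sum_(i < n) int_of_Z (nth Z0 y i) * int_of_Z (f i).
Proof.
elim: n f y => [|n IH] f y.
  by rewrite big_ord0 /dotZ /mkseq /=; case: y.
case: y => [|a y].
  by rewrite /dotZ /= big1 // => i _; rewrite nth_nil mul0r.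
rewrite big_ord_recl /= -(IH (f \o S)) /dotZ /mkseq /=.
have -> : (iota 1 n) = map S (iota 0 n) by rewrite -(iotaDl 1).
rewrite -map_comp; lia.
Qed.

Lemma formZ_mkseq n (c : nat -> nat -> Z) (y : seq Z) :
  int_of_Z (formZ (mkseq (fun i => mkseq (c i) n) n) y)
  = \sum_(i < n) \sum_(j < n)
      int_of_Z (nth Z0 y i) * int_of_Z (nth Z0 y j) * int_of_Z (c i j).
Proof.
rewrite /formZ.
have -> : [seq dotZ y r | r <- mkseq (fun i => mkseq (c i) n) n]
        = mkseq (fun i => dotZ y (mkseq (c i) n)) n by rewrite /mkseq -map_comp.
rewrite dotZ_mkseq; apply: eq_bigr => i _.
by rewrite dotZ_mkseq mulr_sumr; apply: eq_bigr => j _; rewrite mulrA.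
Qed.

(** * Signed graphs with spectrum in [-2, 2] *)

Section SignedGraph.

Variables (V : finType) (B : V -> V -> int).

Definition bounded_form : Prop := forall (e : int) (y : V -> int), e = 1 \/ e = -1 ->
  0 <= \sum_u \sum_v y u * y v * ((u == v)%:R *+ 2 + e * B u v).

(* A pair (v, s) stands for the signed basis vector (-1)^s v. *)
Definition adj (p q : V * bool) : int := (-1) ^+ p.2 * (-1) ^+ q.2 * B p.1 q.1.

Definition realizes n (s : nat -> V * bool) (c : nat -> nat -> Z) : Prop :=
  forall i j, (i < n)%N -> (j < n)%N ->
    ((s i).1 == (s j).1) = (i == j) /\ adj (s i) (s j) = int_of_Z (c i j).

Hypothesis B_bounded : bounded_form.

(** A vector on the window, pushed forward to V with the signs of s and extended by zero, gives the
    form on V the same value. Only integer vectors occur, so [bounded_form] is stated over the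
    integers. *)
Lemma realized_not_forbidden n s c : realizes n s c -> ~~ forbidden n c.
Proof.
move=> Hs.
suff H e : e = Zpos 1 \/ e = Zneg 1 -> ~~ has_negative (shifted_gram e n c).
  by rewrite /forbidden (negbTE (H _ (or_introl erefl))) (negbTE (H _ (or_intror erefl))).
move=> He; rewrite /has_negative; set y := negative_vector _.
pose x i := int_of_Z (nth Z0 y i) * (-1) ^+ (s i).2.
pose Y (v : V) : int := \sum_(i < n) x i * ((s i).1 == v)%:R.
have sumY (g : V -> int) : \sum_v Y v * g v = \sum_(i < n) x i * g (s i).1.
  under eq_bigr do rewrite mulr_suml.
  rewrite exchange_big; apply: eq_bigr => i _ /=.
  rewrite (bigD1 (s i).1) //= eqxx mulr1 big1 ?addr0 // => v /negbTE vs.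
  by rewrite eq_sym vs mulr0 mul0r.
have He' : int_of_Z e = 1 \/ int_of_Z e = -1 by case: He => ->; [left|right].
have := B_bounded Y He'.
suff -> : \sum_u \sum_v Y u * Y v * ((u == v)%:R *+ 2 + int_of_Z e * B u v)
   = int_of_Z (formZ (shifted_gram e n c) y) by lia.
rewrite /shifted_gram formZ_mkseq.
under eq_bigr => u _.
  under eq_bigr do rewrite -mulrA.
  rewrite -mulr_sumr sumY.
  over.
rewrite sumY; apply: eq_bigr => i _; rewrite mulr_sumr; apply: eq_bigr => j _.
have [E1 E2] := Hs i j (ltn_ord i) (ltn_ord j).
have -> : int_of_Z (Z.add (if (i : nat) == j then Zpos 2 else Z0) (Z.mul e (c i j)))
   = (i == j)%:R *+ 2 + int_of_Z e * adj (s i) (s j).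
  rewrite E2 -(inj_eq val_inj) /=.
  by case: He => ->; case: (_ == _); rewrite ?mulr1n ?mul0rn; lia.
rewrite /adj E1 /x.
rewrite -(inj_eq val_inj) /=; case: eqP => [->|_]; last by rewrite mul0rn; ring.
by case: (s j).2; rewrite /= ?expr0 ?expr1; ring.
Qed.

Hypothesis B_sym : forall u v, B u v = B v u.
Hypothesis B_small : forall u v, B u v \in [:: 0; 1; -1].

Lemma adjC p q : adj p q = adj q p.
Proof. by rewrite /adj B_sym [(-1) ^+ p.2 * _]mulrC. Qed.

Definition flip (p : V * bool) : V * bool := (p.1, ~~ p.2).

Lemma adj_flip p q : adj (flip p) q = - adj p q.
Proof. by rewrite /adj /=; case: p.2; rewrite /= ?expr0 ?expr1; ring. Qed.

Lemma adj_small p q : adj p q \in [:: 0; 1; -1].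
Proof.
rewrite /adj; have := B_small p.1 q.1; rewrite !inE.
by case: p.2; case: q.2; case/or3P => /eqP ->; rewrite /= ?expr0 ?expr1.
Qed.

Lemma Z_of_adj p q : Z_of_int (adj p q) \in signsZ.
Proof. by have := adj_small p q; rewrite !inE => /or3P[] /eqP ->. Qed.

Lemma realizes_trunc n m s c : (m <= n)%N -> realizes n s c -> realizes m s c.
Proof. by move=> mn Hs i j im jm; apply: Hs; apply: leq_trans mn. Qed.

Definition append n (s : nat -> V * bool) (r : V * bool) (i : nat) : V * bool :=
  if (i < n)%N then s i else r.

Lemma realizes_bordered n s c r x d : realizes n s c ->
  (forall i, (i < n)%N -> (s i).1 != r.1) ->
  (forall i, (i < n)%N -> adj r (s i) = int_of_Z (nth Z0 x i)) ->
  adj r r = int_of_Z d -> realizes n.+1 (append n s r) (bordered n c x d).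
Proof.
move=> Hs Hr Hx Hd i j; rewrite !ltnS /append /bordered => iN jN.
have [iN'|iN'] := ltnP i n; have [jN'|jN'] := ltnP j n.
- exact: Hs.
- split; last by rewrite adjC Hx.
  by rewrite (negbTE (Hr i _)) //; apply/esym/eqP; lia.
- split; last by rewrite Hx.
  by rewrite eq_sym (negbTE (Hr j _)) //; apply/esym/eqP; lia.
- by split=> //; rewrite eqxx; apply/esym/eqP; lia.
Qed.

(** * Windows of a path and vertices attached to them *)

Definition left_path n (l : Z) (s : nat -> V * bool) : Prop := realizes n s (pathZ l).

Definition twin_at n (l : Z) (s : nat -> V * bool) (i : nat) (r : V * bool) : Prop :=
  [/\ forall j, (j < n)%N -> (s j).1 != r.1,
      forall j, (j < n)%N -> adj r (s j) = int_of_Z (twin_entry l i j)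
    & adj r r = int_of_Z (twin_charge l i)].

Lemma left_path_charge n l s : (0 < n)%N -> left_path n l s -> l \in signsZ.
Proof.
move=> n0 /(_ 0%N 0%N n0 n0)[_ /(congr1 Z_of_int)].
by rewrite /pathZ /= int_of_ZK => <-; apply: Z_of_adj.
Qed.

Lemma bordered_path_forbidden n l s r x d : left_path n l s ->
  (forall i, (i < n)%N -> (s i).1 != r.1) ->
  (forall i, (i < n)%N -> adj r (s i) = int_of_Z (nth Z0 x i)) ->
  adj r r = int_of_Z d -> ~~ forbidden n.+1 (bordered n (pathZ l) x d).
Proof.
move=> Hs Hr Hx Hd; apply: (@realized_not_forbidden _ (append n s r)).
exact: realizes_bordered.
Qed.

Lemma attach_classification l s r p : left_path 11 l s ->
  (forall j, (j < 11)%N -> (s j).1 != r.1) -> (p < 6)%N -> adj r (s p) != 0 ->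
  (exists i q, [/\ (i < 7)%N, q.1 = r.1 & twin_at 11 l s i q]) \/
  [/\ l = Z0, adj r (s 0) != 0 & forall j, (0 < j < 10)%N -> adj r (s j) = 0].
Proof.
move=> Hs Hr p6 rp.
pose x := mkseq (fun j => Z_of_int (adj r (s j))) 11.
pose d := Z_of_int (adj r r).
have lS := left_path_charge (isT : 0 < 11)%N Hs.
have Ex j : (j < 11)%N -> int_of_Z (nth Z0 x j) = adj r (s j).
  by move=> j11; rewrite nth_mkseq // Z_of_intK.
have sr : search (attach_prune l d) (attach_good l d) 11 [::].
  have /allP Al := allP attach_search _ lS; exact/Al/Z_of_adj.
have : attach_good l d x.
apply: (search_sound sr) => [|||m].
- by rewrite size_mkseq.
- by rewrite take0.
- by apply/allP => _ /mapP[j _ ->]; apply: Z_of_adj.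
- rewrite /attach_prune.
  have pm : (p < 6)%N && (p < 11)%N by rewrite p6 (leq_trans p6).
  case: ifP => [/andP[/eqP sz /allP]|_].
    have pm' : (p < size (take m x))%N by rewrite sz.
    move=> /(_ _ (mem_nth Z0 pm')) /Z.eqb_eq.
    have mp : (p < m)%N by move: pm'; rewrite size_take; case: ifP => //; lia.
    rewrite nth_take // => Zp; case/eqP: rp.
    by rewrite -Ex ?Zp //; case/andP: pm.
  case: ifP => // _.
  have szm : (size (take m x) <= 11)%N by rewrite size_take size_mkseq; case: ifP; lia.
  apply: (@bordered_path_forbidden _ _ s r).
  + exact: realizes_trunc Hs.
  + by move=> i iN; apply: Hr; apply: leq_trans szm.
  + move=> i iN; rewrite nth_take ?Ex //; first exact: leq_trans szm.
    by move: iN; rewrite size_take; case: ifP => //; lia.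
  + by rewrite Z_of_intK.
rewrite /attach_good => /orP[/hasP[i]|/andP[/andP[/Z.eqb_eq l0 /allP x0] xh]].
  rewrite mem_iota add0n => /andP[_ i7] /andP[/Z.eqb_eq dE] /orP[] /eqP xE; left.
    exists i, r; split=> //; split=> // [j j11|].
      by rewrite -Ex // xE nth_mkseq.
    by rewrite -dE Z_of_intK.
  (* The table determines the row of r only up to an overall sign, which the other signed copy of
     the same vertex absorbs. *)
  exists i, (flip r); split=> //; split=> // [j j11|].
    rewrite adj_flip -Ex // xE (nth_map Z0) ?size_mkseq // nth_mkseq //; lia.
  by rewrite adj_flip adjC adj_flip opprK -dE Z_of_intK.
right; split=> // [|j /andP[j0 j10]].
  move: xh; rewrite -(Ex 0%N) //= => xh; apply/eqP => h0.
  by move: xh; rewrite /x /= ?h0 //; lia.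
have sz : (j.-1 < size (take 9 (behead x)))%N by rewrite size_take size_behead size_mkseq /=; lia.
have := x0 _ (mem_nth Z0 sz) => /Z.eqb_eq.
have j9 : (j.-1 < 9)%N by lia.
have j11 : (j < 11)%N by lia.
by rewrite nth_take // nth_behead prednK // -Ex // => ->.
Qed.

Lemma left_path_trunc n m l s : (m <= n)%N -> left_path n l s -> left_path m l s.
Proof. exact: realizes_trunc. Qed.

Lemma twin_at_trunc n m l s i q : (m <= n)%N -> twin_at n l s i q -> twin_at m l s i q.
Proof.
move=> mn [H1 H2 H3]; split=> // j jm; [apply: H1|apply: H2]; exact: leq_trans mn.
Qed.

Lemma twin_at_bordered n l s i q : left_path n l s -> twin_at n l s i q ->
  realizes n.+1 (append n s q) (bordered n (pathZ l) (twin_row l n i) (twin_charge l i)).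
Proof.
move=> Hs [Hq1 Hq2 Hq3]; apply: realizes_bordered => // j jn.
by rewrite nth_mkseq ?Hq2.
Qed.

Lemma twin_neighbour_meets_path l s i q z : left_path 10 l s -> (i < 7)%N ->
  twin_at 10 l s i q -> z.1 != q.1 ->
  (forall j, (j < 10)%N -> (s j).1 != z.1) -> (forall j, (j < 10)%N -> adj z (s j) = 0) ->
  adj z q = 0.
Proof.
move=> Hs i7 Hq zq zs z0; apply/eqP; apply/negPn/negP => zq0.
have lS := left_path_charge (isT : 0 < 10)%N Hs.
have bS : Z_of_int (adj z q) \in [:: Zpos 1; Zneg 1].
  by have := adj_small z q; rewrite !inE (negbTE zq0) /= => /orP[] /eqP ->.
have iS : i \in iota 0 7 by rewrite mem_iota.
have /allP Al := allP far_forbidden _ lS.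
have /allP Ai := Al _ iS; have /allP Ad := Ai _ (Z_of_adj z z).
have := Ad _ bS; apply/negP.
apply: (@realized_not_forbidden _ (append 11 (append 10 s q) z)).
apply: realizes_bordered.
- exact: twin_at_bordered.
- move=> j j11; rewrite /append; case: ifP => j10; first exact: zs.
  by rewrite eq_sym.
- move=> j j11; rewrite /append nth_rcons size_nseq; case: ifP => j10.
    by rewrite nth_nseq j10 z0.
  by rewrite ifT ?Z_of_intK //; apply/eqP; lia.
- by rewrite Z_of_intK.
Qed.

Lemma twin_adjacency l s i j p q : left_path 14 l s -> (i < 5)%N -> (i <= j < 12)%N ->
  twin_at 14 l s i p -> twin_at 14 l s j q -> p.1 != q.1 ->
  i != j /\ adj p q = int_of_Z (twin_adj l i j).
Proof.
move=> Hs i5 /andP[ij j12] Hp Hq pq.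
have lS := left_path_charge (isT : 0 < 14)%N Hs.
have iS : i \in iota 0 5 by rewrite mem_iota.
have jS : j \in iota i (12 - i) by rewrite mem_iota ij subnKC //; lia.
have /allP Al := allP pair_forbidden _ lS.
have /allP Ai := Al _ iS; have /allP Aj := Ai _ jS.
have := Aj _ (Z_of_adj p q); case: ifP => [/andP[ij' /eqP <-] _|_].
  by rewrite Z_of_intK.
move=> bad; exfalso; move: bad; apply/negP.
apply: (@realized_not_forbidden _ (append 15 (append 14 s p) q)).
have [Hq1 Hq2 Hq3] := Hq.
apply: realizes_bordered => //.
- exact: twin_at_bordered.
- by move=> m m15; rewrite /append; case: ifP => m14; first exact: Hq1.
- move=> m m15; rewrite /append nth_rcons size_mkseq; case: ifP => m14.
    by rewrite nth_mkseq ?Hq2.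
  by rewrite ifT ?Z_of_intK // 1?adjC //; apply/eqP; lia.
Qed.

Lemma charged_center s : (forall i j, (i < 7)%N -> (j < 7)%N ->
    ((s i).1 == (s j).1) = (i == j) /\ (i != j -> adj (s i) (s j) = int_of_Z (pathZ Z0 i j))) ->
  adj (s 3) (s 3) = 0.
Proof.
move=> Hs; apply/eqP; apply/negPn/negP => c0.
pose ch := mkseq (fun j => Z_of_int (adj (s j) (s j))) 7.
apply: notF; apply: (@search_sound _ (fun=> false) 7 [::] ch charged_center_search) => [|||m].
- by rewrite size_mkseq.
- by rewrite take0.
- by apply/allP => _ /mapP[j _ ->]; apply: Z_of_adj.
case: ifP => // /eqP szm.
have Em j : (j < 7)%N -> nth Z0 (take m ch) j = Z_of_int (adj (s j) (s j)).
  move=> j7; rewrite nth_take ?nth_mkseq //.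
  by move: szm; rewrite size_take; case: ifP => //; lia.
rewrite Em //; case: ifP => [/eqP E|_].
  by case/eqP: c0; rewrite -[LHS]Z_of_intK E.
apply: (@realized_not_forbidden _ s) => i j i7 j7.
have [E1 E2] := Hs i j i7 j7; split=> //.
rewrite /charged_path; case: eqP => [->|/eqP ij]; last exact: E2.
by rewrite Em // Z_of_intK.
Qed.

(** * Longest induced paths *)

Lemma adj_eq0 p q : (adj p q == 0) = (B p.1 q.1 == 0).
Proof. by rewrite /adj !mulf_eq0 !signr_eq0. Qed.

Lemma adj_neq0_eq p p' q : p.1 = p'.1 -> (adj p q == 0) = (adj p' q == 0).
Proof. by move=> pp; rewrite !adj_eq0 pp. Qed.

(* A frame is an induced path with k vertices whose two ends carry the charges l and r. *)
Definition frame_entry (k : nat) (l r : Z) (i j : nat) : Z :=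
  if j == i.+1 then Zpos 1 else if i == j.+1 then Zpos 1 else
  if (i == 0)%N && (j == 0)%N then l else
  if (i == k.-1) && (j == k.-1) then r else Z0.

Definition frame k l r w := realizes k w (frame_entry k l r).

(** The signs at the two ends differ. The end basis vectors have squared lengths 1 - l and 1 - r, so
    the product of an end vertex with its twin is (1 - l) - 1 = -l on the left and 1 - (1 - r) = r
    on the right; the entries of A are the negatives. *)
Definition frame_twin_entry (k : nat) (l r : Z) (i j : nat) : Z :=
  if i == j.+1 then Zpos 1 else if j == i.+1 then Zneg 1 else
  if (i == 0)%N && (j == 0)%N then l else
  if (i == k.-1) && (j == k.-1) then Z.opp r else Z0.

Definition frame_twin k l r (w : nat -> V * bool) (i : nat) (q : V * bool) : Prop :=
  [/\ forall j, (j < k)%N -> (w j).1 != q.1,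
      forall j, (j < k)%N -> adj q (w j) = int_of_Z (frame_twin_entry k l r i j)
    & adj q q = int_of_Z (if i == 0%N then l else if i == k.-1 then r else Z0)].

Definition shift_path (a : nat) (w : nat -> V * bool) (m : nat) := w (a + m)%N.

(** The strict bound [a + n < k] keeps the last vertex, and with it the charge r, out of the
    window. *)
Lemma frame_window k l r w a n : frame k l r w -> (a + n < k)%N ->
  left_path n (if a == 0%N then l else Z0) (shift_path a w).
Proof.
move=> Hw ak i j iN jN; rewrite /shift_path.
have [||E1 E2] := Hw (a + i)%N (a + j)%N; try lia.
rewrite E1 E2 eqn_add2l; split=> //; congr int_of_Z.
rewrite /frame_entry /pathZ; do !case: ifP; lia.
Qed.

Lemma frame_twin_window k l r w i q a n : frame_twin k l r w i q ->
  (a <= i < a + n)%N -> (a + n < k)%N ->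
  twin_at n (if a == 0%N then l else Z0) (shift_path a w) (i - a) q.
Proof.
move=> [H1 H2 H3] ai ak; split=> [j jn|j jn|]; first by apply: H1; lia.
  rewrite /shift_path H2; last by lia.
  congr int_of_Z; rewrite /frame_twin_entry /twin_entry; do !case: ifP; lia.
by rewrite H3; congr int_of_Z; rewrite /twin_charge; do !case: ifP; lia.
Qed.

Definition reverse_path (k : nat) (w : nat -> V * bool) (m : nat) := w (k.-1 - m)%N.

Lemma frame_reverse k l r w : (1 < k)%N -> frame k l r w -> frame k r l (reverse_path k w).
Proof.
move=> k1 Hw i j ik jk; rewrite /reverse_path.
have [||E1 E2] := Hw (k.-1 - i)%N (k.-1 - j)%N; try lia.
rewrite E1 E2; split; first lia.
congr int_of_Z; rewrite /frame_entry; do !case: ifP; lia.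
Qed.

(** Reversal replaces e_i by -e_(k-i). This preserves the vertices e_i - e_(i+1) and negates the
    twins, hence [flip]. *)
Lemma frame_twin_reverse k l r w i q : (1 < k)%N -> (i < k)%N ->
  frame_twin k l r w i q -> frame_twin k r l (reverse_path k w) (k.-1 - i) (flip q).
Proof.
move=> k1 ik [H1 H2 H3]; split=> [j jk|j jk|]; first by apply: H1; lia.
  rewrite /reverse_path adj_flip H2; last by lia.
  rewrite /frame_twin_entry; do !case: ifP; lia.
rewrite adj_flip adjC adj_flip opprK H3; congr int_of_Z; do !case: ifP; lia.
Qed.

Lemma attach_left k l r w q p : frame k l r w ->
  (forall j, (j < k)%N -> (w j).1 != q.1) -> (p + 12 < k)%N -> adj q (w p) != 0 ->
  (exists i q', [/\ (i < k)%N, q'.1 = q.1 & frame_twin k l r w i q']) \/ (p = 0%N /\ l = Z0).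
Proof.
(* The subtraction truncates at 0, so p is always among the first six vertices of the window, at
   position 5 unless the window begins at the end of the path. *)
move=> Hw Hq pk qp; set a := (p - 5)%N.
have W11 : left_path 11 (if a == 0%N then l else Z0) (shift_path a w).
  by apply: frame_window Hw _; lia.
have [|||[i [q' [i7 qq' Htw]]]|[l0 q0 qz]] := @attach_classification _ _ q (p - a) W11.
- by move=> j jn; apply: Hq; lia.
- by lia.
- by rewrite /shift_path subnKC //; lia.
- left; exists (a + i)%N, q'; have [T1 T2 T3] := Htw; split=> //; first by lia.
  split=> [j jk||]; first by rewrite qq' Hq.
  + move=> j jk.
    have [ja|ja] := ltnP j a.
      have i46 : i = 4%N \/ i = 6%N.
        have := T2 5%N isT; rewrite /shift_path.
        have -> : (a + 5)%N = p by lia.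
        move=> E; have : adj q' (w p) != 0 by rewrite (adj_neq0_eq _ qq').
        rewrite E /twin_entry; do !case: ifP; lia.
      (* The window moves one step to the right because [w a.-1] is adjacent to [w a]; with its new
         start, every [w j] to the left of a misses it. *)
      rewrite adjC (@twin_neighbour_meets_path Z0 (shift_path a.+1 w) i.-1 q').
      * rewrite /frame_twin_entry; do !case: ifP; lia.
      * by apply: (@frame_window _ _ _ _ a.+1 10 Hw); lia.
      * by lia.
      * split=> [m mn|m mn|].
        - by rewrite qq' Hq //; lia.
        - have := T2 m.+1; rewrite /shift_path addnS addSn => ->; last by lia.
          congr int_of_Z; rewrite /twin_entry; do !case: ifP; lia.
        - by rewrite T3; congr int_of_Z; rewrite /twin_charge; do !case: ifP; lia.
      * by rewrite qq' Hq.
      * move=> m mn; have [||-> _] := Hw (a.+1 + m)%N j; lia.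
      * move=> m mn; have [||_ ->] := Hw j (a.+1 + m)%N; try lia.
        rewrite /frame_entry; do !case: ifP; lia.
    have [ja'|ja'] := ltnP j (a + 11).
      have := T2 (j - a)%N; rewrite /shift_path subnKC // => ->; last by lia.
      congr int_of_Z; rewrite /twin_entry /frame_twin_entry; do !case: ifP; lia.
    (* Ten of the eleven vertices are used: the omitted one separates the window from every later
       [w j]. *)
    rewrite adjC (@twin_neighbour_meets_path _ (shift_path a w) i q' (w j)
      (left_path_trunc (isT : 10 <= 11)%N W11) i7 (twin_at_trunc (isT : 10 <= 11)%N Htw)).
    * rewrite /frame_twin_entry; do !case: ifP; lia.
    * by rewrite qq' Hq.
    * move=> m mn; have [||-> _] := Hw (a + m)%N j; lia.
    * move=> m mn; have [||_ ->] := Hw j (a + m)%N; try lia.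
      rewrite /frame_entry; do !case: ifP; lia.
  + by rewrite T3; congr int_of_Z; rewrite /twin_charge; do !case: ifP; lia.
- right; have [a0|a0] := eqVneq (p - a)%N 0%N; last first.
    have := qz (p - a)%N; rewrite /shift_path subnKC; last by lia.
    by move=> E; case/eqP: qp; apply: E; lia.
  have p0 : p = 0%N by lia.
  by split=> //; move: l0; case: ifP => //; lia.
Qed.
Definition longest_frame k := forall l r w, ~ frame k.+1 l r w.

(** The old end becomes an interior vertex and must be uncharged, whereas the new end may carry any
    charge. *)
Lemma frame_prepend k l r w q : (1 < k)%N -> frame k l r w -> l = Z0 ->
  (forall j, (j < k)%N -> (w j).1 != q.1) -> adj q (w 0) != 0 ->
  (forall j, (0 < j < k)%N -> adj q (w j) = 0) ->
  exists l' w', frame k.+1 l' r w'.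
Proof.
move=> k1 Hw l0 Hq q0 qz.
have [q' [qq' q1]] : exists q', q'.1 = q.1 /\ adj q' (w 0) = 1.
  have := adj_small q (w 0); rewrite !inE (negbTE q0) /= => /orP[] /eqP E.
    by exists q.
  by exists (flip q); rewrite adj_flip E opprK.
exists (Z_of_int (adj q' q')), (fun m => if m is m'.+1 then w m' else q').
have q0' j : (0 < j < k)%N -> adj q' (w j) = 0.
  by move=> jk; apply/eqP; rewrite (adj_neq0_eq _ qq') qz.
move=> [|i] [|j] ik jk.
- by rewrite !eqxx Z_of_intK.
- split; first by rewrite qq' eq_sym (negbTE (Hq j _)).
  case: j jk => [|j] jk; first by rewrite q1.
  rewrite q0'; last by lia.
  rewrite /frame_entry; do !case: ifP; lia.
- split; first by rewrite qq' (negbTE (Hq i _)).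
  rewrite adjC; case: i ik => [|i] ik; first by rewrite q1.
  rewrite q0'; last by lia.
  rewrite /frame_entry; do !case: ifP; lia.
- have [||E1 E2] := Hw i j; try lia.
  rewrite E1 E2 eqSS; split=> //; congr int_of_Z; rewrite /frame_entry; do !case: ifP; lia.
Qed.

Lemma attach_frame k l r w q : (30 <= k)%N -> frame k l r w -> longest_frame k ->
  (forall j, (j < k)%N -> (w j).1 != q.1) -> (exists2 p, (p < k)%N & adj q (w p) != 0) ->
  (exists i q', [/\ (i < k)%N, q'.1 = q.1 & frame_twin k l r w i q']) \/
  [/\ l = Z0, r = Z0, adj q (w 0) != 0, adj q (w k.-1) != 0 &
     adj q q = 0 /\ forall j, (0 < j < k.-1)%N -> adj q (w j) = 0].
Proof.
move=> k30 Hw Hmax Hq [p0 p0k qp0].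
have k1 : (1 < k)%N by lia.
have Hw' := frame_reverse k1 Hw.
have Hq' j : (j < k)%N -> (reverse_path k w j).1 != q.1 by move=> jk; apply: Hq; lia.
have [T|noT] := classic (exists i q', [/\ (i < k)%N, q'.1 = q.1 & frame_twin k l r w i q']).
  by left.
have ends p : (p < k)%N -> adj q (w p) != 0 -> (p = 0%N /\ l = Z0) \/ (p = k.-1 /\ r = Z0).
  move=> pk qp; have [pl|pr] := ltnP (p + 12) k.
    by have [|] := attach_left Hw Hq pl qp; [move/noT|left].
  have [||[i [q' [ik qq' Tq]]]|[pz rz]] := @attach_left _ _ _ _ q (k.-1 - p) Hw' Hq'.
  - by lia.
  - by rewrite /reverse_path subKn //; lia.
  - case: noT; exists (k.-1 - i)%N, (flip q'); split=> //; first by lia.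
    have [T1 T2 T3] := frame_twin_reverse k1 ik Tq.
    have rK j : (j < k)%N -> reverse_path k (reverse_path k w) j = w j.
      by move=> jk; rewrite /reverse_path subKn //; lia.
    by split=> // j jk; [have := T1 j jk|have := T2 j jk]; rewrite rK.
  - by right; split=> //; lia.
have mid j : (0 < j < k.-1)%N -> adj q (w j) = 0.
  move=> jk; apply/eqP/negPn/negP => qj.
  by have [|[e1 e2]|[e1 e2]] := ends j _ qj; lia.
right; have [q0|q0] := eqVneq (adj q (w 0)) 0; have [qk|qk] := eqVneq (adj q (w k.-1)) 0.
- case/eqP: qp0; have [->//|p00] := eqVneq p0 0%N.
  have [->//|p01] := eqVneq p0 k.-1.
  by apply: mid; lia.
(* A vertex attached at one end only would prolong the path, against maximality. *)
- have r0 : r = Z0 by have [|[e1 e2]|[e1 e2]] := ends _ _ qk; lia.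
  have [||l' [w' /(Hmax _ _ _)[]]] := frame_prepend k1 Hw' r0 Hq'.
  + by rewrite /reverse_path subn0.
  + move=> j jk; rewrite /reverse_path.
    have [->|j1] := eqVneq j k.-1; first by rewrite subnn.
    by apply: mid; lia.
- have l0 : l = Z0 by have [|[e1 e2]|[e1 e2]] := ends _ _ q0; lia.
  have [|l' [w' /(Hmax _ _ _)[]]] := frame_prepend k1 Hw l0 Hq q0.
  move=> j jk; have [->//|j1] := eqVneq j k.-1.
  by apply: mid; lia.
have l0 : l = Z0 by have [|[e1 e2]|[e1 e2]] := ends _ _ q0; lia.
have r0 : r = Z0 by have [|[e1 e2]|[e1 e2]] := ends _ _ qk; lia.
split=> //; split=> //.
(* q is uncharged: otherwise q, w 0, w 1, ... is a path with a charged end to which w (k-1) is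
   attached at that end only. *)
have [s Es] : exists s : nat -> V * bool, left_path 11 (Z_of_int (adj q q)) s
    /\ (s 0%N).1 = q.1 /\ forall m, (0 < m < 11)%N -> (s m).1 = (w m.-1).1.
  have [q' [qq' q1]] : exists q', q'.1 = q.1 /\ adj q' (w 0) = 1.
    have := adj_small q (w 0); rewrite !inE (negbTE q0) /= => /orP[] /eqP E.
      by exists q.
    by exists (flip q); rewrite adj_flip E opprK.
  have qqE : adj q' q' = adj q q.
    rewrite /adj qq'; case: q'.2; case: q.2; rewrite /= ?expr0 ?expr1; ring.
  have q0' j : (0 < j < k.-1)%N -> adj q' (w j) = 0.
    by move=> jk; apply/eqP; rewrite (adj_neq0_eq _ qq') mid.
  exists (fun m => if m is m'.+1 then w m' else q'); split; last by split=> // -[].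
  move=> [|i] [|j] ik jk.
  - by rewrite !eqxx Z_of_intK.
  - have jk' : (j < k)%N by lia.
    split; first by rewrite qq' eq_sym (negbTE (Hq j jk')).
    case: j jk {jk'} => [|j] jk; first by rewrite q1.
    by rewrite q0'; last by lia.
  - have ik' : (i < k)%N by lia.
    split; first by rewrite qq' (negbTE (Hq i ik')).
    rewrite adjC; case: i ik {ik'} => [|i] ik; first by rewrite q1.
    by rewrite q0'; last by lia.
  - have [||E1 E2] := Hw i j; try lia.
    rewrite E1 E2 eqSS l0; split=> //; congr int_of_Z.
    rewrite /frame_entry /pathZ; do !case: ifP; lia.
have [Hs [s0 sm]] := Es.
have Hz j : (j < 11)%N -> (s j).1 != (w k.-1).1.
  case: j => [|j] j11; first by rewrite s0 eq_sym Hq //; lia.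
  rewrite sm //=; have [||-> _] := Hw j k.-1; lia.
have z0 : adj (w k.-1) (s 0) != 0 by rewrite adjC (adj_neq0_eq _ s0).
have zm m : (0 < m < 11)%N -> adj (w k.-1) (s m) = 0.
  move=> m11; apply/eqP; rewrite adjC (adj_neq0_eq _ (sm m m11)).
  have [||_ ->] := Hw m.-1 k.-1; try lia.
  rewrite /frame_entry; do !case: ifP; lia.
case: (attach_classification Hs Hz (isT : 0 < 6)%N z0) => [[i [q' [_ qq' [_ T2 _]]]]|[sz _ _]]; last first.
  by rewrite -[LHS]Z_of_intK sz.
exfalso.
(* The twin of vertex 0 meets vertex 1, and the twin of vertex 1 meets vertex 2, so no twin meets
   vertex 0 alone. *)
have : adj q' (s 0) != 0 by rewrite (adj_neq0_eq _ qq').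
have zm' m : (0 < m < 11)%N -> adj q' (s m) = 0.
  by move=> m11; apply/eqP; rewrite (adj_neq0_eq _ qq') zm.
rewrite T2 //; have := zm' 1%N isT; have := zm' 2%N isT; rewrite !T2 // /twin_entry.
do !case: ifP; lia.
Qed.

Lemma frame_twin_far k l r w i q z : (30 <= k)%N -> frame k l r w -> (i < k)%N ->
  frame_twin k l r w i q -> z.1 != q.1 -> (forall j, (j < k)%N -> (w j).1 != z.1) ->
  (forall j, (j < k)%N -> adj z (w j) = 0) -> adj z q = 0.
Proof.
move=> k30 Hw ik Tq zq zw z0.
have [il|ir] := ltnP (i + 12) k.
  apply: (twin_neighbour_meets_path (frame_window Hw (_ : (i - 5) + 10 < k)%N)
            (_ : i - (i - 5) < 7)%N (frame_twin_window Tq _ _)) => //; try lia.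
  - by move=> j jn; apply: zw; lia.
  - by move=> j jn; apply: z0; lia.
have k1 : (1 < k)%N by lia.
have Hw' := frame_reverse k1 Hw.
have Tq' := frame_twin_reverse k1 ik Tq.
rewrite adjC; apply: oppr_inj; rewrite -adj_flip oppr0 adjC.
apply: (twin_neighbour_meets_path (frame_window Hw' (_ : (k.-1 - i - 5) + 10 < k)%N)
            (_ : k.-1 - i - (k.-1 - i - 5) < 7)%N (frame_twin_window Tq' _ _)) => //; try lia.
- by move=> j jn; apply: zw; lia.
- by move=> j jn; apply: z0; lia.
Qed.
Lemma frame_twin_adj_left k l r w i j p q : (30 <= k)%N -> frame k l r w -> (i <= j < k)%N ->
  frame_twin k l r w i p -> frame_twin k l r w j q -> p.1 != q.1 ->
  (j + 12 < k)%N -> (j <= i + 5)%N ->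
  i != j /\ adj p q = if j == i.+1 then -1 else 0.
Proof.
move=> k30 Hw ijk Tp Tq pq jk ji; set a := (i - 4)%N.
have [|||||||ij ->] := twin_adjacency (frame_window Hw (_ : a + 14 < k)%N)
  (_ : i - a < 5)%N (_ : i - a <= j - a < 12)%N
  (frame_twin_window Tp _ _) (frame_twin_window Tq _ _) pq; try lia.
by split; [lia | rewrite /twin_adj; do !case: ifP; lia].
Qed.

(** If j exceeds i by more than 5, the twin of j misses a window of ten vertices starting at i - 5,
    and the result for remote vertices applies. For i below 5 that window cannot be centred, and j
    below 12 is read from the table of pairs instead. *)
Lemma frame_twin_adj_le k l r w i j p q : (30 <= k)%N -> frame k l r w -> (i <= j < k)%N ->
  frame_twin k l r w i p -> frame_twin k l r w j q -> p.1 != q.1 ->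
  i != j /\ adj p q = if j == i.+1 then -1 else 0.
Proof.
move=> k30 Hw ijk Tp Tq pq.
have k1 : (1 < k)%N by lia.
have [far|near] := ltnP (i + 5) j.
  have [i5|i5] := leqP 5 i; last first.
    have [j12|j12] := ltnP j 12.
      have [|||||||ij ->] := twin_adjacency (frame_window Hw (_ : 0 + 14 < k)%N)
        (_ : i - 0 < 5)%N (_ : i - 0 <= j - 0 < 12)%N
        (frame_twin_window Tp _ _) (frame_twin_window Tq _ _) pq; try lia.
      by split; [lia | rewrite /twin_adj; do !case: ifP; lia].
    have [Q1 Q2 _] := Tq.
    rewrite adjC (@twin_neighbour_meets_path _ _ _ p q
      (frame_window Hw (_ : 0 + 10 < k)%N) (_ : i - 0 < 7)%N (frame_twin_window Tp _ _)) //; try lia.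
    - by split; [lia | case: ifP => //; lia].
    - by rewrite eq_sym.
    - by move=> m mn; apply: Q1; lia.
    - move=> m mn; rewrite /shift_path Q2; last lia.
      by rewrite /frame_twin_entry; do !case: ifP; lia.
  have [Q1 Q2 _] := Tq.
  rewrite adjC (@twin_neighbour_meets_path _ _ _ p q
    (frame_window Hw (_ : (i - 5) + 10 < k)%N) (_ : i - (i - 5) < 7)%N (frame_twin_window Tp _ _)) //; try lia.
  - by split; [lia | case: ifP => //; lia].
  - by rewrite eq_sym.
  - by move=> m mn; apply: Q1; lia.
  - move=> m mn; rewrite /shift_path Q2; last lia.
    by rewrite /frame_twin_entry; do !case: ifP; lia.
have [jl|jr] := ltnP (j + 12) k.
  exact: (frame_twin_adj_left k30 Hw).
have Hw' := frame_reverse k1 Hw.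
have ik : (i < k)%N by lia.
have jk : (j < k)%N by lia.
have Tp' := frame_twin_reverse k1 ik Tp.
have Tq' := frame_twin_reverse k1 jk Tq.
have [||||ij E] := @frame_twin_adj_left _ _ _ _ (k.-1 - j) (k.-1 - i) (flip q) (flip p) k30 Hw' _ Tq' Tp'.
- by lia.
- by rewrite eq_sym.
- by lia.
- by lia.
split; first by lia.
have -> : adj p q = adj (flip q) (flip p) by rewrite [RHS]adj_flip [in RHS]adjC adj_flip opprK.
rewrite E; do !case: ifP; lia.
Qed.

(** The flag distinguishes the vertex e_i - e_(i+1) ([false]) from its twin ([true]). Consecutive
    levels share one basis vector, whose coefficient depends on the flag of the lower level only;
    hence a single sign. *)
Definition linear_entry (k : nat) (l r : int) (i : nat) (b : bool) (j : nat) (c : bool) : int :=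
  if j == i.+1 then (-1) ^+ b else if i == j.+1 then (-1) ^+ c else
  if (i == 0)%N && (j == 0)%N then l else
  if (i == k.-1) && (j == k.-1) then (-1) ^+ b * (-1) ^+ c * r else 0.

Definition frame_place k l r w (i : nat) (b : bool) (q : V * bool) : Prop :=
  (i < k)%N /\ if b then frame_twin k l r w i q else q = w i.

Lemma frame_place_adj k l r w i b p j c q : (30 <= k)%N -> frame k l r w ->
  frame_place k l r w i b p -> frame_place k l r w j c q ->
  (p = q /\ i = j /\ b = c) \/ p.1 != q.1 ->
  adj p q = linear_entry k (int_of_Z l) (int_of_Z r) i b j c /\
  (p.1 != q.1 -> (i, b) != (j, c)).
Proof.
move=> k30 Hw [ik Hp] [jk Hq] [[-> [ij bc]]|pq]; rewrite /linear_entry.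
  subst j c; rewrite eqxx; split=> //.
  case: b Hp Hq => Hp Hq.
    by have [_ _ ->] := Hq; rewrite /= expr1; do !case: ifP; lia.
  have [_] := Hw i i ik ik; rewrite Hq => -> /=; rewrite /frame_entry expr0.
  do !case: ifP; lia.
have neq : (i, b) != (j, c) -> p.1 != q.1 -> (i, b) != (j, c) by [].
rewrite xpair_eqE; case: b c Hp Hq {neq} => -[] Hp Hq; rewrite /= ?expr0 ?expr1.
- have [ij|ji] := leqP i j.
    have [|ij' ->] := frame_twin_adj_le k30 Hw _ Hp Hq pq; first by lia.
    split; last by lia.
    do !case: ifP; lia.
  have [||ij' E] := frame_twin_adj_le k30 Hw (_ : j <= i < k)%N Hq Hp; first by lia.
    by rewrite eq_sym.
  rewrite adjC E; split; last by lia.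
  do !case: ifP; lia.
- have [_ E _] := Hp; rewrite Hq E //; split; last by lia.
  rewrite /frame_twin_entry; do !case: ifP; lia.
- have [_ E _] := Hq; rewrite Hp adjC E //; split; last by lia.
  rewrite /frame_twin_entry; do !case: ifP; lia.
- have [E1 E2] := Hw i j ik jk; rewrite Hp Hq E2; split; last first.
    by move: pq; rewrite Hp Hq E1; lia.
  rewrite /frame_entry; do !case: ifP; lia.
Qed.

Definition closes_frame (k : nat) (w : nat -> V * bool) (q : V * bool) : Prop :=
  [/\ forall j, (j < k)%N -> (w j).1 != q.1, adj q (w 0) != 0, adj q (w k.-1) != 0 &
     adj q q = 0 /\ forall j, (0 < j < k.-1)%N -> adj q (w j) = 0].

Hypothesis B_connected : forall u v, connect (fun x y => B x y != 0) u v.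

Lemma connected_closed (P : V -> Prop) u : P u ->
  (forall x y, P x -> B x y != 0 -> P y) -> forall v, P v.
Proof.
move=> Pu Pstep v; have /connectP[s] := B_connected u v.
elim: s u Pu => [|x s IH] u Pu /=; first by move=> _ ->.
by move=> /andP[ux pth]; apply: IH => //; apply: Pstep ux.
Qed.

(** The path vertices and their twins are closed under adjacency: a new vertex that meets the path
    is a twin by [attach_frame], and one that misses the path cannot meet a twin. *)
Lemma frame_place_total k l r w : (30 <= k)%N -> frame k l r w -> longest_frame k ->
  (l = Z0 -> r = Z0 -> forall q, ~ closes_frame k w q) ->
  forall v, exists i b q, frame_place k l r w i b q /\ q.1 = v.
Proof.
move=> k30 Hw Hmax Hno.
have k0 : (0 < k)%N by lia.
apply: (@connected_closed _ (w 0).1); first by exists 0%N, false, (w 0).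
move=> x y [i [b [q [[ik Hq] qx]]]] xy.
have [[j [jk jy]]|nj] := classic (exists j, (j < k)%N /\ (w j).1 = y).
  by exists j, false, (w j).
have yw j : (j < k)%N -> (w j).1 != (y, false).1.
  by move=> jk; apply/eqP => jy; apply: nj; exists j.
have [yp|nyp] := classic (exists2 p, (p < k)%N & adj (y, false) (w p) != 0).
  have [[j [q' [jk qq' T]]]|[l0 r0 y0 yk [yy ym]]] := attach_frame k30 Hw Hmax yw yp.
    by exists j, true, q'.
  by case: (Hno l0 r0 (y, false)).
have y0 j : (j < k)%N -> adj (y, false) (w j) = 0.
  by move=> jk; apply/eqP/negPn/negP => h; apply: nyp; exists j.
case: b Hq => Hq; last first.
  by have /eqP := y0 i ik; rewrite adj_eq0 -Hq qx B_sym (negbTE xy).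
have [yq|yq] := eqVneq y q.1; first by exists i, true, q.
have /eqP := @frame_twin_far _ _ _ _ _ _ (y, false) k30 Hw ik Hq yq yw y0.
by rewrite adj_eq0 /= B_sym qx (negbTE xy).
Qed.
(** * Long induced cycles *)

Definition sflip (b : bool) (p : V * bool) := if b then flip p else p.

Lemma adj_sflip b p q : adj (sflip b p) q = (-1) ^+ b * adj p q.
Proof. by case: b; rewrite /= ?adj_flip ?mulN1r ?mul1r. Qed.

Lemma sflip_fst b p : (sflip b p).1 = p.1.
Proof. by case: b. Qed.

Lemma sflipK b : involutive (sflip b).
Proof. by case: b => // -[v s]; rewrite /sflip /flip /= negbK. Qed.

Lemma adj_sflip2 b p q : adj (sflip b p) (sflip b q) = adj p q.
Proof. by rewrite adj_sflip adjC adj_sflip mulrA -expr2 sqrr_sign mul1r adjC. Qed.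

(* The cycle is unrolled to a sequence of signed vertices that is periodic up to the sign s of the
   cycle. *)
Definition cyclic_frame (k : nat) (s : bool) (w : nat -> V * bool) : Prop :=
  (forall j, w (j + k)%N = sflip s (w j)) /\ forall a, left_path k.-1 Z0 (shift_path a w).

Lemma closed_frame_cyclic k w q : (30 <= k)%N -> frame k Z0 Z0 w -> closes_frame k w q ->
  exists s w', cyclic_frame k.+1 s w'.
Proof.
move=> k30 Hw [Hq q0 qk [qq qz]].
have [q' [qq' q1]] : exists q', q'.1 = q.1 /\ adj q' (w k.-1) = 1.
  have := adj_small q (w k.-1); rewrite !inE (negbTE qk) /= => /orP[] /eqP E.
    by exists q.
  by exists (flip q); rewrite adj_flip E opprK.
have qqE : adj q' q' = 0 by apply/eqP; move/eqP: qq; rewrite !adj_eq0 qq'.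
pose s := adj q' (w 0%N) == -1.
have q0' : adj q' (w 0) = (-1) ^+ s.
  have : adj q' (w 0) != 0 by rewrite (adj_neq0_eq _ qq').
  rewrite /s; have := adj_small q' (w 0); rewrite !inE.
  by case/or3P => /eqP ->.
have qz' j : (0 < j < k.-1)%N -> adj q' (w j) = 0.
  by move=> jk; apply/eqP; rewrite (adj_neq0_eq _ qq') qz.
pose base m := if (m < k)%N then w m else q'.
have base_neq m n : (m < n < k.+1)%N -> (base m).1 != (base n).1.
  move=> mn; rewrite /base ifT; last by lia.
  case: ifP => nk; last by rewrite qq' Hq //; lia.
  have [||-> _] := Hw m n; lia.
have base_adj m n : (m < n < k.+1)%N ->
    adj (base m) (base n) = if n == m.+1 then 1 else if (n - m == k)%N then (-1) ^+ s else 0.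
  move=> mn; rewrite /base ifT; last by lia.
  case: ifP => nk.
    have [||_ ->] := Hw m n; try lia.
    rewrite /frame_entry; do !case: ifP; lia.
  have -> : n = k by lia.
  rewrite adjC; have [->|mk] := eqVneq m k.-1.
    by rewrite q1 ifT //; lia.
  have [->|m0] := eqVneq m 0%N; first by rewrite q0' subn0 eqxx ifF //; lia.
  rewrite qz'; last by lia.
  by rewrite ifF ?ifF //; lia.
have base_charge m : (m < k.+1)%N -> adj (base m) (base m) = 0.
  move=> mk; rewrite /base; case: ifP => // mk'.
  have [_ ->] := Hw m m mk' mk'; rewrite /frame_entry; do !case: ifP; lia.
(* Each completed turn contributes the sign of the closing edge, so that consecutive terms have
   weight 1 across the seam too. *)
pose w' j := sflip (s && odd (j %/ k.+1)%N) (base (j %% k.+1)%N).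
have w'_le x y : (x <= y < x + k)%N ->
    ((w' x).1 == (w' y).1) = (x == y) /\ adj (w' x) (w' y) = if y == x.+1 then 1 else 0.
  move=> xy; rewrite /w' !sflip_fst adj_sflip adjC adj_sflip mulrA.
  have xm := ltn_pmod x (ltn0Sn k); have ym := ltn_pmod y (ltn0Sn k).
  have xE := divn_eq x k.+1; have yE := divn_eq y k.+1.
  move: (x %/ k.+1)%N (x %% k.+1)%N (y %/ k.+1)%N (y %% k.+1)%N xm ym xE yE => X m Y n mk nk xE yE.
  have [[YX nm]|[YX nm]] : (Y = X /\ n = m + (y - x))%N \/ (Y = X.+1 /\ n + k.+1 = m + (y - x))%N.
    have XY : (X <= Y)%N by nia.
    have YX : (Y <= X.+1)%N by nia.
    have [YX'|YX'] := eqVneq Y X; [left|right]; first by subst Y; split=> //; lia.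
    have YE : Y = X.+1 by lia.
    by split=> //; subst Y; lia.
  - rewrite YX -signr_addb addbb mul1r adjC.
    have [xy0|xy0] := eqVneq x y.
      have -> : n = m by lia.
      by rewrite eqxx base_charge // ifF //; lia.
    have mn : (m < n < k.+1)%N by lia.
    rewrite (negbTE (base_neq _ _ mn)) base_adj //; split=> //.
    have -> : (n == m.+1) = (y == x.+1) by lia.
    by case: ifP => // _; rewrite ifF //; lia.
  - have nm' : (n < m < k.+1)%N by lia.
    rewrite eq_sym (negbTE (base_neq _ _ nm')) base_adj //; split; first lia.
    rewrite YX /=.
    have -> : (m == n.+1) = false by lia.
    have -> : (m - n == k)%N = (y == x.+1) by lia.
    case: ifP => _; last by rewrite mulr0.
    by case: (s); case: (odd X).
exists s, w'; split=> [j|a i j].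
  rewrite /w' divnDr // divnn /= modnDr addn1 /=.
  by case: (s); case: (odd _) => //=; case: (base _) => v b; rewrite /flip /= negbK.
rewrite /= /shift_path => ik jk; have [ij|ji] := leqP i j.
  have [|-> ->] := w'_le (a + i)%N (a + j)%N; first by lia.
  split; first lia.
  rewrite /pathZ; do !case: ifP; lia.
rewrite eq_sym adjC; have [|-> ->] := w'_le (a + j)%N (a + i)%N; first by lia.
split; first lia.
rewrite /pathZ; do !case: ifP; lia.
Qed.
(* The twin of w (a + 1). *)
Definition cyclic_twin (k : nat) (w : nat -> V * bool) (a : nat) (q : V * bool) : Prop :=
  [/\ forall j, (w j).1 != q.1, adj q q = 0 &
      forall d, (d < k)%N -> adj q (w (a + d)%N) = int_of_Z (twin_entry Z0 1 d)].

Definition cyclic_place k w (a : nat) (b : bool) (q : V * bool) : Prop :=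
  if b then cyclic_twin k w a q else q = w a.+1.

(** This allows every position to be moved one turn ahead, where subtracting a window offset does
    not truncate. *)
Lemma cyclic_place_shift k s w a b q : cyclic_frame k s w ->
  cyclic_place k w a b q <-> cyclic_place k w (a + k) b (sflip s q).
Proof.
move=> [per _]; case: b => /=; last first.
  rewrite -addSn per; split=> [->//|/(congr1 (sflip s))]; by rewrite !sflipK.
have E d : adj (sflip s q) (w (a + k + d)%N) = adj q (w (a + d)%N).
  by rewrite addnAC per adj_sflip2.
split=> -[H1 H2 H3]; split.
- by move=> j; rewrite sflip_fst.
- by rewrite adj_sflip2.
- by move=> d dk; rewrite E H3.
- by move=> j; have := H1 j; rewrite sflip_fst.
- by move: H2; rewrite adj_sflip2.
- by move=> d dk; rewrite -E H3.
Qed.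

Lemma cyclic_twin_zero k s w a q x : cyclic_frame k s w -> cyclic_twin k w a q ->
  (x < a /\ a + 3 <= x + k)%N \/ (a + 3 <= x < a + k)%N -> adj q (w x) = 0.
Proof.
move=> [per _] [_ _ H] [xa|xa].
  apply/eqP; have := H (x + k - a)%N; rewrite subnKC; last by lia.
  rewrite per adjC adj_sflip adjC => E.
  have : (-1) ^+ s * adj q (w x) == 0.
    rewrite E; last by lia.
    by rewrite /twin_entry; do !case: ifP; lia.
  by rewrite mulf_eq0 signr_eq0.
have := H (x - a)%N; rewrite subnKC; last by lia.
move=> ->; last by lia.
rewrite /twin_entry; do !case: ifP; lia.
Qed.

Lemma attach_cyclic k s w q p : (30 <= k)%N -> cyclic_frame k s w ->
  (forall j, (w j).1 != q.1) -> adj q (w p) != 0 ->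
  exists a q', q'.1 = q.1 /\ cyclic_place k w a true q'.
Proof.
move=> k30 [per win] Hq qp.
(* One turn further, p is large enough for a window starting five vertices earlier, and it sits at
   position 5 exactly. The alternative of a vertex attached at position 0 alone is thereby
   excluded. *)
have qp' : adj q (w (p + k)%N) != 0 by rewrite per adjC adj_sflip mulf_neq0 ?signr_eq0 // adjC.
set a := (p + k - 5)%N.
have aE : (a + 5 = p + k)%N by lia.
have W11 : left_path 11 Z0 (shift_path a w) by apply: left_path_trunc (win a); lia.
have [|||[i [q' [i7 qq' Htw]]]|[_ q0 qz]] := @attach_classification _ _ q 5 W11.
- by move=> j jn; apply: Hq.
- by [].
- by rewrite /shift_path aE.
- have [T1 T2 T3] := Htw.
  have q'5 : adj q' (w (a + 5)%N) != 0 by rewrite (adj_neq0_eq _ qq') aE.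
  have i46 : i = 4%N \/ i = 6%N.
    have := T2 5%N isT; rewrite /shift_path => E; move: q'5; rewrite E /twin_entry.
    do !case: ifP; lia.
  exists (a + i.-1)%N, q'; split=> //; split.
  + by move=> j; rewrite qq' Hq.
  + by rewrite T3 /twin_charge; do !case: ifP; lia.
  move=> d dk; set x := (a + i.-1 + d)%N.
  have [x11|x11] := ltnP x (a + 11).
    have := T2 (x - a)%N; rewrite /shift_path subnKC; last by lia.
    move=> ->; last by lia.
    congr int_of_Z; rewrite /twin_entry; do !case: ifP; lia.
  have -> : int_of_Z (twin_entry Z0 1 d) = 0 by rewrite /twin_entry; do !case: ifP; lia.
  have [xk1|xk1] := ltnP x (a + k.-1).
    rewrite adjC (@twin_neighbour_meets_path Z0 (shift_path a w) i q' (w x)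
      (left_path_trunc (isT : 10 <= 11)%N W11) i7 (twin_at_trunc (isT : 10 <= 11)%N Htw)) //.
    * by rewrite qq' Hq.
    * move=> m mn; have [||] := win a m (x - a)%N; try lia.
      by rewrite /shift_path subnKC; [move=> -> _|]; lia.
    * move=> m mn; have [||_] := win a (x - a)%N m; try lia.
      rewrite /shift_path subnKC; last by lia.
      by move=> ->; rewrite /pathZ; do !case: ifP; lia.
  (* What remains here is [x = a + k.-1], a neighbour of [w a] around the cycle, so the window is
     moved one step away from it. *)
  have [xk|xk] := ltnP x (a + k).
    rewrite adjC (@twin_neighbour_meets_path Z0 (shift_path a.+1 w) i.-1 q' (w x)) //.
    * by apply: left_path_trunc (win a.+1); lia.
    * by lia.
    * split=> [m mn|m mn|]; first by rewrite qq' Hq.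
        have := T2 m.+1; rewrite /shift_path addnS addSn => ->; last by lia.
        congr int_of_Z; rewrite /twin_entry; do !case: ifP; lia.
      by rewrite T3; congr int_of_Z; rewrite /twin_charge; do !case: ifP; lia.
    * by rewrite qq' Hq.
    * move=> m mn; have [||] := win a.+1 m (x - a.+1)%N; try lia.
      by rewrite /shift_path subnKC; [move=> -> _|]; lia.
    * move=> m mn; have [||_] := win a.+1 (x - a.+1)%N m; try lia.
      rewrite /shift_path subnKC; last by lia.
      by move=> ->; rewrite /pathZ; do !case: ifP; lia.
  have -> : x = (x - k + k)%N by lia.
  rewrite per adjC adj_sflip adjC; have := T2 (x - k - a)%N.
  rewrite /shift_path subnKC; last by lia.
  move=> ->; last by lia.
  rewrite /twin_entry; do !case: ifP; lia.
- by case/eqP: qp'; rewrite -aE; apply: (qz 5%N).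
Qed.

Lemma cyclic_twin_window k s w a q t n : cyclic_frame k s w -> cyclic_twin k w a q ->
  (t <= a)%N -> (a + 3 <= t + k)%N -> (t + n <= a + k)%N ->
  twin_at n Z0 (shift_path t w) (a.+1 - t) q.
Proof.
move=> Hw Tq ta akt tn; have [H1 H2 H3] := Tq; split=> [j _|j jn|].
- exact: H1.
- rewrite /shift_path; have [lt|le] := ltnP (t + j) a.
    rewrite (cyclic_twin_zero Hw Tq); last by left; lia.
    by rewrite /twin_entry; do !case: ifP; lia.
  have := H3 (t + j - a)%N; rewrite subnKC // => ->; last by lia.
  congr int_of_Z; rewrite /twin_entry; do !case: ifP; lia.
- by rewrite H2 /twin_charge; do !case: ifP; lia.
Qed.

Lemma cyclic_twin_far k s w a q z t : cyclic_frame k s w -> (30 <= k)%N -> cyclic_twin k w a q ->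
  z.1 != q.1 -> (forall j, (w j).1 != z.1) -> (a <= t + 5)%N -> (t <= a)%N ->
  (forall j, (j < 10)%N -> adj z (w (t + j)%N) = 0) -> adj z q = 0.
Proof.
move=> Hw k30 Tq zq zw at5 ta z0.
apply: (@twin_neighbour_meets_path Z0 (shift_path t w) (a.+1 - t)) => //; try lia.
- by apply: left_path_trunc (Hw.2 t); lia.
- by apply: cyclic_twin_window Hw Tq _ _ _; lia.
- by move=> j _; apply: zw.
Qed.

Lemma cyclic_twin_near k s w a a' p q : (30 <= k)%N -> cyclic_frame k s w ->
  cyclic_twin k w a p -> cyclic_twin k w a' q -> p.1 != q.1 -> (a <= a' <= a + 7)%N ->
  a != a' /\ adj p q = if a' == a.+1 then -1 else 0.
Proof.
move=> k30 Hw Tp Tq pq aa'.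
have Tp' : cyclic_twin k w (a + k) (sflip s p) by have [+ _] := cyclic_place_shift a true p Hw; apply.
have Tq' : cyclic_twin k w (a' + k) (sflip s q) by have [+ _] := cyclic_place_shift a' true q Hw; apply.
pose t := (a + k - 3)%N.
have W : left_path 14 Z0 (shift_path t w) by apply: left_path_trunc (Hw.2 t); lia.
have [|||||||||ij] := twin_adjacency W (_ : (a + k).+1 - t < 5)%N
  (_ : (a + k).+1 - t <= (a' + k).+1 - t < 12)%N
  (cyclic_twin_window Hw Tp' _ _ _) (cyclic_twin_window Hw Tq' _ _ _); try lia.
by rewrite !sflip_fst.
rewrite adj_sflip2 => ->; split; first lia.
rewrite /twin_adj; do !case: ifP; lia.
Qed.
(** Two twins can be close in either direction around the cycle; in the backward direction a' is
    compared with the shifted position [a + k]. The bound on a' leaves out the pair adjacent across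
    the seam, which [cyclic_place_adj] treats by a shift. *)
Lemma cyclic_place_adj_le k s w a a' b c p q : (30 <= k)%N -> cyclic_frame k s w ->
  cyclic_place k w a b p -> cyclic_place k w a' c q -> p.1 != q.1 -> (a <= a')%N ->
  (a' + 2 <= a + k)%N ->
  (a, b) != (a', c) /\ adj p q = if a' == a.+1 then (-1) ^+ b else 0.
Proof.
move=> k30 Hw Hp Hq pq aa' a'a; rewrite xpair_eqE.
case: b c Hp Hq => -[] Hp Hq; rewrite /= ?expr0 ?expr1 ?andbT ?andbF.
- have [near|far] := leqP a' (a + 7).
    have [|ne ->] := cyclic_twin_near k30 Hw Hp Hq pq; first by lia.
    by [].
  have Hp' := proj1 (cyclic_place_shift a true p Hw) Hp.
  have Hq' := proj1 (cyclic_place_shift a' true q Hw) Hq.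
  split; first by lia.
  rewrite ifF; last by lia.
  have [le8|gt8] := leqP (a' + 8) (a + k).
    rewrite -(adj_sflip2 s) adjC (cyclic_twin_far (t := (a + k - 4)%N) Hw k30 Hp') //; try lia.
    + by rewrite !sflip_fst eq_sym.
    + by move=> j; case: Hq' => + _ _; apply.
    + move=> j j10; apply: (cyclic_twin_zero Hw Hq'); lia.
  have [||_ E] := cyclic_twin_near (a := a') (a' := (a + k)%N) (p := q) (q := sflip s p) k30 Hw Hq Hp' _.
  + by rewrite sflip_fst eq_sym.
  + by lia.
  apply/eqP; have : adj q (sflip s p) == 0 by rewrite E ifF //; lia.
  by rewrite adjC adj_sflip mulf_eq0 signr_eq0.
- move: Hp => [_ _ H]; rewrite Hq; split=> //.
  have -> : a'.+1 = (a + (a'.+1 - a))%N by lia.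
  rewrite H; last by lia.
  rewrite /twin_entry; do !case: ifP; lia.
- have [_ _ H] := Hq; rewrite Hp; split=> //.
  rewrite adjC; have [lt|ge] := ltnP a.+1 a'.
    rewrite ifF; last by lia.
    apply: (@cyclic_twin_zero k s w a') => //; last by left; lia.
  have aE : a.+1 = (a' + (a.+1 - a'))%N by lia.
  rewrite {1}aE H; last by lia.
  rewrite /twin_entry; do !case: ifP; lia.
- have [||] := Hw.2 a.+1 0%N (a' - a)%N; try lia.
  rewrite /shift_path addn0 addSn subnKC // -Hp -Hq => E1 ->.
  split; first by move: pq; rewrite E1; lia.
  rewrite /pathZ; do !case: ifP; lia.
Qed.

(** As in [linear_entry] the flag of the preceding level gives the sign; across the seam the
    preceding level is [k.-1]. *)
Definition cyclic_entry (k : nat) (s : bool) (i : nat) (b : bool) (j : nat) (c : bool) : int :=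
  if j == i.+1 then (-1) ^+ b else if i == j.+1 then (-1) ^+ c else
  if (i == 0)%N && (j == k.-1) then (-1) ^+ s * (-1) ^+ c else
  if (j == 0)%N && (i == k.-1) then (-1) ^+ s * (-1) ^+ b else 0.

Lemma cyclic_place_adj k s w i b p j c q : (30 <= k)%N -> cyclic_frame k s w ->
  (i < k)%N -> (j < k)%N -> cyclic_place k w i b p -> cyclic_place k w j c q ->
  (p = q /\ i = j /\ b = c) \/ p.1 != q.1 ->
  adj p q = cyclic_entry k s i b j c /\ (p.1 != q.1 -> (i, b) != (j, c)).
Proof.
move=> k30 Hw ik jk Hp Hq [[pq [ij bc]]|].
  subst j c p; rewrite eqxx; split=> //.
  have -> : cyclic_entry k s i b i b = 0 by rewrite /cyclic_entry; do !case: ifP; lia.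
  case: b Hp Hq => [|_] Hq; first by case: Hq.
  rewrite Hq; have [||_] := Hw.2 i 1%N 1%N; try lia.
  by rewrite /shift_path addn1 => ->.
move: ik jk Hp Hq; wlog ij : i b p j c q / (i <= j)%N => [H ik jk Hp Hq pq|ik jk Hp Hq pq].
  have [ij|ji] := leqP i j; first exact: H.
  have [||||||E1 E2] := H j c q i b p; rewrite // 1?eq_sym //; first lia.
  rewrite adjC E1; split; last by move=> _; rewrite eq_sym E2 // eq_sym.
  rewrite /cyclic_entry; do !case: ifP => //; lia.
have [le|gt] := leqP (j + 2) (i + k).
  have [ne ->] := cyclic_place_adj_le k30 Hw Hp Hq pq ij le.
  split=> //; rewrite /cyclic_entry; do !case: ifP => //; lia.
have [i0 j0] : i = 0%N /\ j = k.-1 by lia.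
have Hp' := proj1 (cyclic_place_shift i b p Hw) Hp.
have [|||_ E] := cyclic_place_adj_le k30 Hw Hq Hp'.
- by rewrite sflip_fst eq_sym.
- by lia.
- by lia.
split; last by rewrite xpair_eqE; lia.
have -> : adj p q = (-1) ^+ s * adj q (sflip s p).
  by rewrite [in RHS]adjC adj_sflip mulrA -expr2 sqrr_sign mul1r.
rewrite E /cyclic_entry; do !case: ifP => //; lia.
Qed.

Lemma cyclic_place_reduce k s w a b q : (0 < k)%N -> cyclic_frame k s w ->
  cyclic_place k w a b q -> exists a' q', [/\ (a' < k)%N, q'.1 = q.1 & cyclic_place k w a' b q'].
Proof.
move=> k0 Hw; have [n] := ubnP a; elim: n a q => // n IH a q an Hq.
have [ak|ka] := ltnP a k; first by exists a, q.
have [||a' [q' [a'k qq' Hq']]] := IH (a - k)%N (sflip s q); first by lia.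
  by apply/(cyclic_place_shift _ _ _ Hw); rewrite subnK // sflipK.
by exists a', q'; rewrite sflip_fst in qq'; split.
Qed.

Lemma cyclic_place_total k s w : (30 <= k)%N -> cyclic_frame k s w ->
  forall v, exists i b q, [/\ (i < k)%N, cyclic_place k w i b q & q.1 = v].
Proof.
move=> k30 Hw.
suff tot v : exists i b q, cyclic_place k w i b q /\ q.1 = v.
  move=> v; have [i [b [q [Hq qv]]]] := tot v.
  have [|i' [q' [ik qq' Hq']]] := cyclic_place_reduce _ Hw Hq; first by lia.
  by exists i', b, q'; rewrite qq'.
move: v; apply: (@connected_closed _ (w 1).1); first by exists 0%N, false, (w 1).
move=> x y [i [b [q [Hq qx]]]] xy.
have [[j jy]|nj] := classic (exists j, (w j.+1).1 = y).
  by exists j, false, (w j.+1).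
have yw j : (w j).1 != (y, false).1.
  apply/eqP => jy; apply: nj; exists (j + k.-1)%N.
  by rewrite -addnS prednK ?Hw.1 ?sflip_fst //; lia.
have [yp|nyp] := classic (exists p, adj (y, false) (w p) != 0).
  have [p yp'] := yp.
  by have [a [q' [qq' Hq']]] := attach_cyclic k30 Hw yw yp'; exists a, true, q'.
have y0 j : adj (y, false) (w j) = 0.
  by apply/eqP/negPn/negP => h; apply: nyp; exists j.
case: b Hq => Hq; last first.
  by have /eqP := y0 i.+1; rewrite adj_eq0 -Hq qx B_sym (negbTE xy).
have [yq|yq] := eqVneq y q.1; first by exists i, true, q.
have /eqP := @cyclic_twin_far _ _ _ _ _ (y, false) i Hw k30 Hq yq yw (leq_addr _ _) (leqnn _) (fun j _ => y0 _).
by rewrite adj_eq0 /= B_sym qx (negbTE xy).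
Qed.
Hypothesis B_degree : forall u, (#|[set v | B u v != 0]| <= 4)%N.

(** * Existence of a long induced path *)

Definition neighbourhood (S : {set V}) : {set V} :=
  S :|: \bigcup_(u in S) [set v | B u v != 0].

Definition ball (u0 : V) (j : nat) : {set V} := iter j neighbourhood [set u0].

Lemma card_neighbourhood S : (#|neighbourhood S| <= 5 * #|S|)%N.
Proof.
apply: leq_trans (leq_card_setU _ _).1 _; rewrite mulSn leq_add2l.
apply: (@leq_trans (\sum_(u in S) 4)); last by rewrite sum_nat_const mulnC.
apply: (@leq_trans (\sum_(u in S) #|[set v | B u v != 0]|)); last exact: leq_sum.
elim/big_rec2: _ => [|u m T uS IH]; first by rewrite cards0.
by apply: leq_trans (leq_card_setU _ _).1 _; rewrite leq_add2l.
Qed.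

Lemma card_ball u0 j : (#|ball u0 j| <= 5 ^ j)%N.
Proof.
elim: j => [|j IH]; first by rewrite cards1.
by apply: leq_trans (card_neighbourhood _) _; rewrite expnS leq_mul2l IH orbT.
Qed.

Lemma ball_le u0 i j : (i <= j)%N -> ball u0 i \subset ball u0 j.
Proof.
move=> /subnKC <-; elim: (j - i)%N => [|m IH]; rewrite ?addn0 // addnS.
exact: subset_trans IH (subsetUl _ _).
Qed.

Lemma ball_step u0 j u v : u \in ball u0 j -> B u v != 0 -> v \in ball u0 j.+1.
Proof.
by move=> uj uv; rewrite !inE; apply/orP; right; apply/bigcupP; exists u; rewrite ?inE.
Qed.

Definition layer (u0 : V) (j : nat) (v : V) : Prop :=
  v \in ball u0 j /\ forall i, (i < j)%N -> v \notin ball u0 i.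

Lemma layer_inj u0 i j v : layer u0 i v -> layer u0 j v -> i = j.
Proof.
move=> [vi ni] [vj nj]; case: (ltngtP i j) => // [/nj|/ni]; by rewrite ?vi ?vj.
Qed.

Lemma layer_adjacent u0 i j u v : layer u0 i u -> layer u0 j v -> B u v != 0 -> (j <= i.+1)%N.
Proof.
move=> [ui _] [_ nj] uv; rewrite leqNgt; apply/negP => /nj.
by rewrite (ball_step ui uv).
Qed.

Lemma layer_pred u0 j v : layer u0 j.+1 v -> exists u, layer u0 j u /\ B u v != 0.
Proof.
move=> [vj nj]; move: vj; rewrite !inE => /orP[vj|/bigcupP[u uj]].
  by have := nj j (ltnSn j); rewrite vj.
rewrite inE => uv; exists u; split=> //; split=> // i ij; apply/negP => ui.
by have := nj i.+1 ij; rewrite (ball_step ui uv).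
Qed.

Lemma layer_path u0 j v : layer u0 j v -> exists s : nat -> V * bool,
  [/\ (s j).1 = v, forall i, (i <= j)%N -> layer u0 i (s i).1 &
      forall i, (i < j)%N -> adj (s i) (s i.+1) = 1].
Proof.
elim: j v => [|j IH] v vj.
  by exists (fun=> (v, false)); split=> // i; rewrite leqn0 => /eqP ->.
have [u [uj uv]] := layer_pred vj; have [s [sj sl sa]] := IH u uj.
have [q [qv qa]] : exists q, q.1 = v /\ adj q (s j) = 1.
  have qn : adj (v, false) (s j) != 0 by rewrite adj_eq0 /= sj B_sym.
  have := adj_small (v, false) (s j); rewrite !inE (negbTE qn) /= => /orP[] /eqP E.
    by exists (v, false).
  by exists (flip (v, false)); rewrite adj_flip E opprK.
exists (fun i => if (i <= j)%N then s i else q); split.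
- by rewrite ltnn.
- move=> i ij; case: ifP => [|ij']; first exact: sl.
  have -> : i = j.+1 by lia.
  by rewrite qv.
- move=> i ij; rewrite ifT; last by lia.
  case: ifP => [|ij']; first exact: sa.
  have -> : i = j by lia.
  by rewrite adjC.
Qed.

Lemma far_layer u0 R : (5 ^ R < #|V|)%N -> exists v, layer u0 R.+1 v.
Proof.
move=> RV.
have [[v [vR vR']]|nv] := classic (exists v, v \in ball u0 R.+1 /\ v \notin ball u0 R).
  exists v; split=> // i iR; apply: contra vR' => vi.
  by apply: (subsetP (ball_le u0 _)) vi.
suff : ball u0 R = setT.
  by move=> E; have := card_ball u0 R; rewrite E cardsT leqNgt RV.
apply/setP => v; rewrite inE; apply: (@connected_closed (fun v => v \in ball u0 R) u0).
  by apply: (subsetP (ball_le u0 (leq0n R))); rewrite inE.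
move=> x y xR xy; apply/negPn/negP => yR; apply: nv; exists y; split=> //.
exact: ball_step xy.
Qed.

(** A geodesic is induced because an edge changes the distance from [u0] by at most 1. Three
    vertices are cut off at its start and at least three at its end, so that each remaining vertex
    is the centre of seven and therefore uncharged. *)
Lemma long_frame R : (5 ^ R < #|V|)%N -> (6 <= R)%N -> exists w, frame (R - 5) Z0 Z0 w.
Proof.
move=> RV R6; have /card_gt0P[u0 _] : (0 < #|V|)%N by apply: leq_trans RV.
have [v vR] := far_layer u0 RV; have [s [_ sl sa]] := layer_path vR.
have sP i j : (i <= R.+1)%N -> (j <= R.+1)%N ->
    ((s i).1 == (s j).1) = (i == j) /\ (i != j -> adj (s i) (s j) = int_of_Z (pathZ Z0 i j)).
  move=> iR jR; split.
    by apply/eqP/eqP => [E|->] //; apply: layer_inj (sl i iR) _; rewrite E; apply: sl.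
  wlog ij : i j iR jR / (i < j)%N => [H ij|_].
    have [lt|ge] := ltnP i j; first exact: H.
    rewrite adjC H //; try lia.
    by congr int_of_Z; rewrite /pathZ; do !case: ifP; lia.
  have [->|ij1] := eqVneq j i.+1; first by rewrite sa /pathZ ?eqxx //; lia.
  have -> : adj (s i) (s j) = 0.
    apply/eqP/negPn; rewrite adj_eq0; apply/negP => E.
    by have := layer_adjacent (sl i iR) (sl j jR) E; lia.
  by rewrite /pathZ; do !case: ifP; lia.
have s0 i : (3 <= i)%N -> (i + 3 <= R.+1)%N -> adj (s i) (s i) = 0.
  move=> i3 iR; have := @charged_center (shift_path (i - 3) s).
  rewrite /shift_path subnK //; apply=> a b a7 b7.
  have [||E1 E2] := sP (i - 3 + a)%N (i - 3 + b)%N; try lia.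
  rewrite E1 eqn_add2l; split=> // ab; rewrite E2 ?eqn_add2l //.
  by congr int_of_Z; rewrite /pathZ; do !case: ifP; lia.
exists (shift_path 3 s) => i j iR jR; rewrite /shift_path.
have [||E1 E2] := sP (3 + i)%N (3 + j)%N; try lia.
split; first by rewrite E1 eqn_add2l.
have [->|ij] := eqVneq i j.
  rewrite s0; try lia.
  by rewrite /frame_entry; do !case: ifP; lia.
rewrite E2; last by lia.
by congr int_of_Z; rewrite /frame_entry /pathZ; do !case: ifP; lia.
Qed.

Lemma frame_size k l r w : frame k l r w -> (k <= #|V|)%N.
Proof.
move=> Hw; rewrite -[k]card_ord.
apply: (@leq_card _ _ (fun i : 'I_k => (w i).1)) => i j /eqP.
by have [-> _] := Hw i j (ltn_ord i) (ltn_ord j) => /eqP /val_inj.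
Qed.

Lemma exists_longest_frame k l r w : frame k l r w ->
  exists k' l' r' w', [/\ (k <= k')%N, frame k' l' r' w' & longest_frame k'].
Proof.
have [n] := ubnP (#|V| - k)%N; elim: n k l r w => // n IH k l r w kn Hw.
have [Hmax|nmax] := classic (longest_frame k); first by exists k, l, r, w.
have [l' [r' [w' Hw']]] : exists l' r' w', frame k.+1 l' r' w'.
  apply: NNPP => no; apply: nmax => l' r' w' Hw'; apply: no.
  by exists l', r', w'.
have kV := frame_size Hw'.
have [|k2 [l2 [r2 [w2 [kk2 H1 H2]]]]] := IH _ _ _ _ _ Hw'; first by lia.
by exists k2, l2, r2, w2; split=> //; lia.
Qed.

Definition signed_copy (entry : nat -> bool -> nat -> bool -> int) (k : nat) : Prop :=
  exists (f : V -> nat * bool) (g : V -> bool),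
    [/\ injective f, forall v, ((f v).1 < k)%N &
        forall u v, B u v = (-1) ^+ g u * (-1) ^+ g v *
                            entry (f u).1 (f u).2 (f v).1 (f v).2].

Lemma placed_signed_copy (place : nat -> bool -> V * bool -> Prop) entry k :
  (forall v, exists i b q, [/\ (i < k)%N, place i b q & q.1 = v]) ->
  (forall i b p j c q, (i < k)%N -> (j < k)%N -> place i b p -> place j c q ->
    (p = q /\ i = j /\ b = c) \/ p.1 != q.1 ->
    adj p q = entry i b j c /\ (p.1 != q.1 -> (i, b) != (j, c))) ->
  signed_copy entry k.
Proof.
move=> tot Hadj.
have [F HF] : exists F : V -> nat * bool * bool, forall v,
    ((F v).1.1 < k)%N /\ place (F v).1.1 (F v).1.2 (v, (F v).2).
  apply: (@fin_all_exists V (fun=> (nat * bool * bool)%type)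
    (fun v t => (t.1.1 < k)%N /\ place t.1.1 t.1.2 (v, t.2))) => v; have [i [b [[q s] [ik Hq /= qv]]]] := tot v.
  by exists (i, b, s) => /=; rewrite -qv.
exists (fun v => (F v).1), (fun v => (F v).2).
have Huv (u v : V) : (u = v) \/ u != v by case: eqVneq; [left|right].
have H u v := Hadj _ _ _ _ _ _ (proj1 (HF u)) (proj1 (HF v)) (proj2 (HF u)) (proj2 (HF v)).
split=> [u v /eqP E|v|u v]; first last.
- have [|+ _] := H u v; first by case: (Huv u v) => [->|]; [left|right].
  rewrite /adj /= => <-.
  by case: (F u).2; case: (F v).2; rewrite /= ?expr0 ?expr1; ring.
- by have [] := HF v.
apply/eqP/negPn/negP => uv; have [|_] := H u v; first by right.
by move/(_ uv); rewrite -!surjective_pairing E.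
Qed.

Theorem large_signed_copy R : (5 ^ R < #|V|)%N -> (35 <= R)%N ->
  (exists k l r, [/\ (30 <= k)%N, l \in [:: 0; 1; -1], r \in [:: 0; 1; -1] &
                    signed_copy (linear_entry k l r) k]) \/
  (exists k s, (30 <= k)%N /\ signed_copy (cyclic_entry k s) k).
Proof.
move=> RV R35; have [|w0 Hw0] := long_frame RV; first by lia.
have [k [l [r [w [kR Hw Hmax]]]]] := exists_longest_frame Hw0.
have k30 : (30 <= k)%N by lia.
have charge m : (m < k)%N -> int_of_Z (frame_entry k l r m m) \in [:: 0; 1; -1].
  by move=> mk; have [_ <-] := Hw m m mk mk; apply: adj_small.
have [[q [l0 [r0 Hc]]]|nc] := classic (exists q, l = Z0 /\ r = Z0 /\ closes_frame k w q).
  right; subst l r; have [s [w' Hw']] := closed_frame_cyclic k30 Hw Hc.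
  have k31 : (30 <= k.+1)%N by lia.
  exists k.+1, s; split=> //; apply: (placed_signed_copy (cyclic_place_total k31 Hw')).
  by move=> *; apply: (cyclic_place_adj k31 Hw').
left; exists k, (int_of_Z l), (int_of_Z r); split=> //.
- have := charge 0%N; rewrite /frame_entry /=; apply; lia.
- have := charge k.-1; rewrite /frame_entry eqxx.
  have -> : (k.-1 == k.-1.+1) = false by lia.
  have -> : (k.-1 == 0%N) = false by lia.
  by apply; lia.
apply: (@placed_signed_copy (frame_place k l r w)) => [v|].
  have [|i [b [q [Hq qv]]]] := frame_place_total k30 Hw Hmax _ v.
    by move=> l0 r0 q Hq; apply: nc; exists q.
  by exists i, b, q; split=> //; case: Hq.
by move=> i b p j c q _ _ Hp Hq; apply: (frame_place_adj k30 Hw).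
Qed.

End SignedGraph.

(** * Two families of integer matrices of square 4 *)

Section InvolutionMatrix.

Variables (I : finType) (partner : I * bool -> I * bool) (sg : I * bool -> int).
Hypothesis partnerK : involutive partner.
Hypothesis sg_partner : forall c, sg (partner c) = sg c.
Hypothesis sg_sq : forall c, sg c * sg c = 1.

(* For each i in I the vectors (1, 1) and (1, -1) on the two indices over i give an orthogonal basis;
   the matrix below is twice the signed permutation of that basis given by partner and sg. *)
Definition hadamard (d s : bool) : int := (-1) ^+ (d && s).

Definition involution_entry (x y : I * bool) : int :=
  \sum_(d : bool) \sum_(e : bool)
    (partner (x.1, d) == (y.1, e))%:R * (sg (x.1, d) * hadamard d x.2 * hadamard e y.2).

Lemma involution_entryC x y : involution_entry x y = involution_entry y x.
Proof.
rewrite /involution_entry exchange_big; apply: eq_bigr => e _; apply: eq_bigr => d _.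
have -> : (partner (y.1, e) == (x.1, d)) = (partner (x.1, d) == (y.1, e)).
  by rewrite -(inj_eq (inv_inj partnerK)) partnerK eq_sym.
by case: eqP => [<-|]; rewrite ?mul0r // sg_partner mulrAC.
Qed.

Lemma involution_entryE x y : involution_entry x y =
  \sum_(d : bool) ((partner (x.1, d)).1 == y.1)%:R *
    (sg (x.1, d) * hadamard d x.2 * hadamard (partner (x.1, d)).2 y.2).
Proof.
apply: eq_bigr => d _; case: (partner _) => m e.
rewrite big_bool !xpair_eqE /=; case: e; case: eqP; rewrite /= ?mul0r ?mul1r ?addr0 ?add0r //.
Qed.

Lemma involution_entry_hadamard m e y :
  \sum_(u : bool) hadamard e u * involution_entry (m, u) y =
  2 * sg (m, e) * ((partner (m, e)).1 == y.1)%:R * hadamard (partner (m, e)).2 y.2.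
Proof.
rewrite big_bool !involution_entryE /= !big_bool /hadamard /=.
by case: e => /=; rewrite ?expr0 ?expr1; ring.
Qed.

Lemma involution_entry_sq x y :
  \sum_z involution_entry x z * involution_entry z y = 4 * (x == y)%:R.
Proof.
transitivity (\sum_(m : I) \sum_(u : bool) involution_entry x (m, u) * involution_entry (m, u) y).
  by rewrite pair_big; apply: eq_bigr => -[].
(* One factor 2 is the squared length of a Hadamard vector; the other arises at the end, where the
   product of the two [hadamard] values summed over d is 2 or 0. *)
transitivity (\sum_(d : bool) 2 * (x.1 == y.1)%:R * (hadamard d x.2 * hadamard d y.2)).
  transitivity (\sum_(d : bool) sg (x.1, d) * hadamard d x.2 *
     \sum_(m : I) (m == (partner (x.1, d)).1)%:R *
       \sum_(u : bool) hadamard (partner (x.1, d)).2 u * involution_entry (m, u) y).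
    under eq_bigr do under eq_bigr do rewrite involution_entryE /= mulr_suml.
    under eq_bigr do rewrite exchange_big /=.
    rewrite exchange_big; apply: eq_bigr => d _.
    rewrite mulr_sumr; apply: eq_bigr => m _; rewrite !mulr_sumr; apply: eq_bigr => u _.
    by rewrite (eq_sym m); ring.
  apply: eq_bigr => d _; set c := partner (x.1, d).
  rewrite (bigD1 c.1) //= [X in _ * (_ + X)]big1 ?addr0; last by move=> m mc; rewrite (negbTE mc) mul0r.
  rewrite eqxx mul1r involution_entry_hadamard -surjective_pairing /c partnerK sg_partner /=.
  have := sg_sq (x.1, d); move: (sg _) => t tt.
  transitivity (2 * (x.1 == y.1)%:R * (hadamard d x.2 * hadamard d y.2) * (t * t)); first by ring.
  by rewrite tt mulr1.
rewrite big_bool /hadamard /=; case: x y => [i s] [j t]; rewrite xpair_eqE /=.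
by case: (i == j); case: s; case: t; rewrite /= ?expr0 ?expr1; ring.
Qed.

End InvolutionMatrix.

Section LevelMatrices.

Variable n : nat.
Hypothesis n0 : (0 < n)%N.

(** The sum and the difference of e_i - e_(i+1) and e_i + e_(i+1) are, up to sign, 2 e_i (flag
    [false]) and 2 e_(i+1) (flag [true]). Flag [true] at level i and flag [false] at level i + 1
    thus name the same basis vector and are exchanged; the two outer ones are fixed, with the end
    charges as signs. *)
Definition linear_partner (c : 'I_n.+1 * bool) : 'I_n.+1 * bool :=
  if c.2 then (if c.1 == n :> nat then c else (inord c.1.+1, false))
  else (if c.1 == 0%N :> nat then c else (inord c.1.-1, true)).

Definition linear_sign (l r : int) (c : 'I_n.+1 * bool) : int :=
  if c.2 then (if c.1 == n :> nat then r else 1) else (if c.1 == 0%N :> nat then l else 1).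

Definition cyclic_partner (c : 'I_n.+1 * bool) : 'I_n.+1 * bool :=
  if c.2 then (if c.1 == n :> nat then (ord0, false) else (inord c.1.+1, false))
  else (if c.1 == 0%N :> nat then (ord_max, true) else (inord c.1.-1, true)).

Definition cyclic_sign (s : bool) (c : 'I_n.+1 * bool) : int :=
  if c.2 then (if c.1 == n :> nat then (-1) ^+ s else 1)
  else (if c.1 == 0%N :> nat then (-1) ^+ s else 1).

Lemma pair_ord_eq (x y : 'I_n.+1 * bool) : (x == y) = (x.1 == y.1 :> nat) && (x.2 == y.2).
Proof. by []. Qed.

Lemma inord_succE (i : 'I_n.+1) : (i == n :> nat) = false -> nat_of_ord (@inord n i.+1) = i.+1.
Proof. by move=> E; rewrite inordK //; have := ltn_ord i; lia. Qed.

Lemma inord_predE (i : 'I_n.+1) : nat_of_ord (@inord n i.-1) = i.-1.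
Proof. by rewrite inordK //; have := ltn_ord i; lia. Qed.

Lemma linear_partnerK : involutive linear_partner.
Proof.
case=> i b; rewrite /linear_partner; have iN := ltn_ord i; case: b => /=.
  case E: (i == n :> nat); rewrite /= ?E // inord_succE //=; congr pair; exact: inord_val.
case E: (i == 0%N :> nat); rewrite /= ?E // inord_predE ifF; last by lia.
by congr pair; rewrite prednK ?inord_val //; lia.
Qed.

Lemma cyclic_partnerK : involutive cyclic_partner.
Proof.
case=> i b; rewrite /cyclic_partner; have iN := ltn_ord i; case: b => /=.
  case E: (i == n :> nat) => /=; first by congr pair; apply: val_inj => /=; lia.
  rewrite inord_succE //=; congr pair; exact: inord_val.
case E: (i == 0%N :> nat) => /=; first by rewrite eqxx; congr pair; apply: val_inj => /=; lia.
rewrite inord_predE ifF; last by lia.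
by congr pair; rewrite prednK ?inord_val //; lia.
Qed.

Lemma linear_sign_partner l r c : linear_sign l r (linear_partner c) = linear_sign l r c.
Proof.
case: c => i b; rewrite /linear_sign /linear_partner; have iN := ltn_ord i; case: b => /=.
  by case E: (i == n :> nat); rewrite /= ?E // inord_succE.
by case E: (i == 0%N :> nat); rewrite /= ?E // inord_predE ifF //; lia.
Qed.

Lemma cyclic_sign_partner s c : cyclic_sign s (cyclic_partner c) = cyclic_sign s c.
Proof.
case: c => i b; rewrite /cyclic_sign /cyclic_partner; have iN := ltn_ord i; case: b => /=.
  by case E: (i == n :> nat); rewrite /= ?E // inord_succE.
by case E: (i == 0%N :> nat); rewrite /= ?E ?eqxx // inord_predE ifF //; lia.
Qed.

Lemma linear_sign_sq l r c : l * l = 1 -> r * r = 1 -> linear_sign l r c * linear_sign l r c = 1.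
Proof. by move=> ll rr; rewrite /linear_sign; do !case: ifP. Qed.

Lemma cyclic_sign_sq s c : cyclic_sign s c * cyclic_sign s c = 1.
Proof. by rewrite /cyclic_sign; do !case: ifP; rewrite // -expr2 sqrr_sign. Qed.

Lemma linear_involution_entry l r (x y : 'I_n.+1 * bool) :
  involution_entry linear_partner (linear_sign l r) x y = linear_entry n.+1 l r x.1 x.2 y.1 y.2.
Proof.
case: x y => i b [j c]; have iN := ltn_ord i; have jN := ltn_ord j.
rewrite /involution_entry !big_bool !pair_ord_eq /linear_partner /linear_sign /linear_entry /hadamard /=.
case Ein: (i == n :> nat); case Ei0: (i == 0%N :> nat);
  rewrite /= ?inord_predE ?inord_succE //= ?andbT ?andbF;
  case: b; case: c; rewrite /= ?expr0 ?expr1;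
  do !case: eqP => ? /=; rewrite ?expr0 ?expr1; first [exfalso; lia | ring].
Qed.

(** With only two levels the consecutive pair and the pair across the seam would coincide and their
    contributions would add up; hence [1 < n]. *)
Lemma cyclic_involution_entry s (x y : 'I_n.+1 * bool) : (1 < n)%N ->
  involution_entry cyclic_partner (cyclic_sign s) x y = cyclic_entry n.+1 s x.1 x.2 y.1 y.2.
Proof.
move=> n1; case: x y => i b [j c]; have iN := ltn_ord i; have jN := ltn_ord j.
rewrite /involution_entry !big_bool !pair_ord_eq /cyclic_partner /cyclic_sign /cyclic_entry /hadamard /=.
move: (_ ^+ s) => t.
case Ein: (i == n :> nat); case Ei0: (i == 0%N :> nat);
  rewrite /= ?inord_predE ?inord_succE //= ?andbT ?andbF;
  case: b; case: c; rewrite /= ?expr0 ?expr1;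
  do !case: eqP => ? /=; rewrite ?expr0 ?expr1; first [exfalso; lia | ring].
Qed.

Lemma levels_connected (E : rel ('I_n.+1 * bool)) : symmetric E ->
  (forall x y : 'I_n.+1 * bool, (y.1 : nat) = x.1.+1 -> E x y) -> forall x y, connect E x y.
Proof.
move=> Es E1.
have Cs : connect_sym E by apply: sym_connect_sym.
suff H x : connect E x (ord0, false).
  by move=> x y; apply: connect_trans (H x) _; rewrite Cs.
case: x => i b; have [m] := ubnP (i : nat); elim: m i b => // m IH i b im.
have [i0|i0] := posnP i.
  (* The relation is given only between consecutive levels, so the two vertices of level 0 are
     joined through level 1. *)
  apply: (@connect_trans _ _ (inord 1, false)); first by apply/connect1/E1; rewrite /= inordK //; lia.
  by rewrite Cs; apply/connect1/E1; rewrite /= inordK //; lia.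
apply: (@connect_trans _ _ (inord i.-1, false)).
  by rewrite Cs; apply/connect1/E1; rewrite inord_predE /=; lia.
by apply: IH; rewrite inord_predE; lia.
Qed.

End LevelMatrices.

(** * Embedding large signed graphs into matrices of square 4 *)

Definition integral_completion (V : finType) (B : V -> V -> int) : Prop :=
  exists (U : finType) (T : U -> U -> int) (F : V -> U),
    [/\ forall x y, T x y = T y x,
        forall x y, \sum_z T x z * T z y = 4 * (x == y)%:R,
        forall x y, connect (fun x y => T x y != 0) x y,
        injective F & forall u v, B u v = T (F u) (F v)].

(* An uncharged end is closed by adding one more level of charge 1. *)
Lemma linear_entry_close (k : nat) (l r : int) : l \in [:: 0; 1; -1] -> r \in [:: 0; 1; -1] ->
  (2 <= k)%N -> exists (k' a : nat) (l' r' : int), [/\ l' * l' = 1, r' * r' = 1, (k + a <= k')%N &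
    forall i b j c, (i < k)%N -> (j < k)%N ->
      linear_entry k l r i b j c = linear_entry k' l' r' (i + a) b (j + a) c].
Proof.
move=> lS rS k2.
exists (k + (l == 0) + (r == 0))%N, (l == 0 : nat), (if l == 0 then 1 else l), (if r == 0 then 1 else r).
split; last first.
- move=> i b j c ik jk; rewrite /linear_entry.
  move: lS rS; rewrite !inE => /or3P[] /eqP -> /or3P[] /eqP ->; rewrite ?eqxx /= ?mulr0 ?mulr1;
    case: b; case: c; rewrite ?expr0 ?expr1; do !case: ifP; lia.
- by rewrite leq_addr.
- by move: rS; rewrite !inE => /or3P[] /eqP ->.
- by move: lS; rewrite !inE => /or3P[] /eqP ->.
Qed.

Section Completion.

Variables (V : finType) (B : V -> V -> int).

Lemma signed_copy_completion n entry (T : 'I_n.+1 * bool -> 'I_n.+1 * bool -> int) :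
  (0 < n)%N -> signed_copy B entry n.+1 ->
  (forall x y : 'I_n.+1 * bool, T x y = entry x.1 x.2 y.1 y.2) ->
  (forall i b c, entry i b i.+1 c != 0) ->
  (forall x y, T x y = T y x) ->
  (forall x y, \sum_z T x z * T z y = 4 * (x == y)%:R) ->
  integral_completion B.
Proof.
move=> n0 [f [g [finj fk fB]]] TE entry0 TC Tsq.
pose F v : 'I_n.+1 * bool := (inord (f v).1, (f v).2).
have Fv v : nat_of_ord (inord (f v).1 : 'I_n.+1) = (f v).1 by rewrite inordK.
have Finj : injective F.
  move=> u v [E1 E2]; apply: finj; rewrite [f u]surjective_pairing [f v]surjective_pairing E2.
  by rewrite -(Fv u) -(Fv v) E1.
(* The switching signs g are extended to all indices, with an arbitrary value off the image of F;
   conjugation by a diagonal sign matrix preserves the square. *)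
pose G x := if [pick v | F v == x] is Some v then g v else false.
have GF v : G (F v) = g v.
  by rewrite /G; case: pickP => [u /eqP /Finj ->|/(_ v)] //; rewrite eqxx.
exists ('I_n.+1 * bool)%type, (fun x y => (-1) ^+ G x * (-1) ^+ G y * T x y), F; split=> //.
- by move=> x y; rewrite TC (mulrC (_ ^+ G x)).
- move=> x y; transitivity ((-1) ^+ G x * (-1) ^+ G y * \sum_z T x z * T z y).
    rewrite mulr_sumr; apply: eq_bigr => z _.
    transitivity ((-1) ^+ G z * (-1) ^+ G z * ((-1) ^+ G x * (-1) ^+ G y * (T x z * T z y)));
      last by rewrite -expr2 sqrr_sign mul1r.
    by move: (_ ^+ G x) (_ ^+ G y) (_ ^+ G z) => a b c; ring.
  rewrite Tsq; case: eqP => [->|_]; last by rewrite !mulr0.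
  by rewrite -expr2 sqrr_sign mul1r.
- apply: (levels_connected n0) => [x y|x y xy].
    by rewrite TC (mulrC (_ ^+ G x)).
  by rewrite !mulf_neq0 ?signr_eq0 // TE xy.
- by move=> u v; rewrite !GF fB TE /F /= !Fv.
Qed.

Lemma linear_completion k l r : (2 <= k)%N -> l \in [:: 0; 1; -1] -> r \in [:: 0; 1; -1] ->
  signed_copy B (linear_entry k l r) k -> integral_completion B.
Proof.
move=> k2 lS rS [f [g [finj fk fB]]].
have [k' [a [l' [r' [ll rr kk' E]]]]] := linear_entry_close lS rS k2.
case: k' kk' E => [|n] kk' E; first by lia.
have n0 : (0 < n)%N by lia.
apply: (@signed_copy_completion n (linear_entry n.+1 l' r')
          (involution_entry (@linear_partner n) (linear_sign l' r'))) => //.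
- exists (fun v => ((f v).1 + a, (f v).2)%N), g; split=> [u v [/addIn E1 E2]|v|u v] /=.
  + by apply: finj; rewrite [f u]surjective_pairing [f v]surjective_pairing E1 E2.
  + by have := fk v; lia.
  + by rewrite fB E.
- by move=> x y; rewrite linear_involution_entry.
- by move=> i b c; rewrite /linear_entry eqxx signr_eq0.
- by move=> x y; apply: involution_entryC; [exact: linear_partnerK|move=> c; exact: linear_sign_partner].
- move=> x y; apply: involution_entry_sq; first exact: linear_partnerK.
    by move=> c; exact: linear_sign_partner.
  by move=> c; exact: linear_sign_sq.
Qed.

Lemma cyclic_completion k s : (3 <= k)%N ->
  signed_copy B (cyclic_entry k s) k -> integral_completion B.
Proof.
case: k => [|n] // n2 copy; have n1 : (1 < n)%N by lia.
have n0 : (0 < n)%N by lia.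
apply: (@signed_copy_completion n (cyclic_entry n.+1 s)
          (involution_entry (@cyclic_partner n) (cyclic_sign s))) => //.
- by move=> x y; rewrite cyclic_involution_entry.
- by move=> i b c; rewrite /cyclic_entry eqxx signr_eq0.
- by move=> x y; apply: involution_entryC; [exact: cyclic_partnerK|move=> c; exact: cyclic_sign_partner].
- move=> x y; apply: involution_entry_sq; first exact: cyclic_partnerK.
    by move=> c; exact: cyclic_sign_partner.
  by move=> c; exact: cyclic_sign_sq.
Qed.

Theorem large_completion R : bounded_form B -> (forall u v, B u v = B v u) ->
  (forall u v, B u v \in [:: 0; 1; -1]) ->
  (forall u v, connect (fun x y => B x y != 0) u v) ->
  (forall u, (#|[set v | B u v != 0]| <= 4)%N) ->
  (35 <= R)%N -> (5 ^ R < #|V|)%N -> integral_completion B.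
Proof.
move=> Bb Bs Bsm Bc Bd R35 RV.
have [[k [l [r [k30 lS rS]]]]|[k [s [k30]]]] := large_signed_copy Bb Bs Bsm Bc Bd RV R35.
  by apply: linear_completion => //; lia.
by apply: cyclic_completion; lia.
Qed.

End Completion.

(** * Consequences of the spectral theorem *)

Local Notation "M ^t*" := (map_mx Num.conj (trmx M)) (at level 30).

(** A polynomial that is nonnegative on [-2, 2] takes a positive semidefinite value at A. Degree 2
    covers the two uses: 4 - z^2 for the row bounds, and 2 + z, 2 - z for the integral forms. *)
Lemma cyclotomic_form_ge0 n (A : 'M[algC]_n) (a b c : algC) (x : 'rV[algC]_n) : cyclotomic A ->
  (forall z : algC, -2 <= z <= 2 -> 0 <= a + b * z + c * (z * z)) ->
  (forall i, x 0 i \is Num.real) ->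
  0 <= (x *m (a%:M + b *: A + c *: (A *m A)) *m x^T) 0 0.
Proof.
move=> [Areal Asym _ Aeig] Hz xreal.
have xC : map_mx Num.conj x = x by apply/matrixP => i j; rewrite !mxE ord1; apply/CrealP.
have AC : A ^t* = A by rewrite Asym; apply/matrixP => i j; rewrite mxE; apply/CrealP.
have /orthomx_spectralP : A \is normalmx by apply/normalmxP; rewrite AC.
set P := spectralmx A; set D := spectral_diag A => AE.
have Pu : P \is unitarymx := spectral_unitarymx A.
have Punit : P \in unitmx := spectral_unit A.
have PA : P *m A = diag_mx D *m P by rewrite {1}AE -mulmxA mulKVmx.
have Dz i : -2 <= D 0 i <= 2.
  apply: Aeig; apply/eigenvalueP; exists (row i P).
    by rewrite -row_mul PA row_mul row_diag_mx -scalemxAl -rowE.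
  apply/negP => /eqP r0; have /matrixP/(_ 0 i) : row i (P *m invmx P) = 0 by rewrite row_mul r0 mul0mx.
  by rewrite mulmxV // !mxE eqxx => /eqP; rewrite oner_eq0.
have -> : a%:M + b *: A + c *: (A *m A)
   = invmx P *m diag_mx (\row_i (a + b * D 0 i + c * (D 0 i * D 0 i))) *m P.
  have E : P *m (a%:M + b *: A + c *: (A *m A))
     = diag_mx (\row_i (a + b * D 0 i + c * (D 0 i * D 0 i))) *m P.
    rewrite !mulmxDr -!scalemxAr mulmxA PA -mulmxA PA mulmxA mulmx_diag.
    rewrite mul_mx_scalar !mul_diag_mx; apply/matrixP => i j; rewrite !mxE; ring.
  by rewrite -mulmxA -E mulKmx.
rewrite invmx_unitary // !mulmxA -mulmxA mxE; apply: sumr_ge0 => i _.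
have -> : (P *m x^T) i 0 = Num.conj ((x *m P ^t*) 0 i).
  rewrite !mxE rmorph_sum; apply: eq_bigr => j _.
  by rewrite !mxE rmorphM /= conjCK mulrC; congr (_ * _); apply/esym/CrealP.
rewrite mul_mx_diag mxE mxE mulrAC -normCK mulr_ge0 ?exprn_ge0 //.
by rewrite mxE; apply: Hz.
Qed.

Lemma cyclotomic_sum_ge0 n (A : 'M[algC]_n) (a b c : algC) (x : 'I_n -> algC) : cyclotomic A ->
  (forall z : algC, -2 <= z <= 2 -> 0 <= a + b * z + c * (z * z)) ->
  (forall i, x i \is Num.real) ->
  0 <= \sum_i x i * \sum_j x j * (a * (i == j)%:R + b * A i j + c * \sum_k A i k * A k j).
Proof.
move=> cycA Hz xreal; have := @cyclotomic_form_ge0 n A a b c (\row_i x i) cycA Hz.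
suff -> : (\row_i x i *m (a%:M + b *: A + c *: (A *m A)) *m (\row_i x i)^T) 0 0
   = \sum_i x i * \sum_j x j * (a * (i == j)%:R + b * A i j + c * \sum_k A i k * A k j).
  by apply=> i; rewrite mxE.
rewrite mxE; under eq_bigr do rewrite mxE mulr_suml.
rewrite exchange_big; apply: eq_bigr => i _; rewrite mulr_sumr; apply: eq_bigr => j _.
by rewrite !mxE mulr_natr; ring.
Qed.

Lemma sum_indicator n (i : 'I_n) (F : 'I_n -> algC) : \sum_j (j == i)%:R * F j = F i.
Proof.
by rewrite (bigD1 i) //= eqxx mul1r big1 ?addr0 // => j /negbTE ->; rewrite mul0r.
Qed.

Lemma four_minus_sq_ge0 (z : algC) : -2 <= z <= 2 -> 0 <= 4 + 0 * z + -1 * (z * z).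
Proof.
move=> /andP[z1 z2]; have -> : 4 + 0 * z + -1 * (z * z) = (2 - z) * (z - -2) by ring.
by rewrite mulr_ge0 ?subr_ge0.
Qed.

Lemma cyclotomic_sym n (A : 'M[algC]_n) i j : cyclotomic A -> A i j = A j i.
Proof. by move=> [_ Asym _ _]; rewrite -{1}Asym mxE. Qed.

Lemma gram_bound n (A : 'M[algC]_n) i : cyclotomic A -> \sum_j A i j ^+ 2 <= 4.
Proof.
move=> cycA; have := cyclotomic_sum_ge0 cycA four_minus_sq_ge0 (fun j => realn _ (j == i)).
rewrite !sum_indicator eqxx mulr1 mul0r addr0 mulN1r subr_ge0.
by under eq_bigr do rewrite (cyclotomic_sym _ i cycA) -expr2.
Qed.

Lemma gram_orthogonal n (A : 'M[algC]_n) i k : cyclotomic A -> \sum_j A i j ^+ 2 = 4 -> i != k ->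
  \sum_j A i j * A j k = 0.
Proof.
move=> cycA E ik; have [Areal _ _ _] := cycA.
pose G p q := \sum_j A p j * A j q.
have Greal p q : G p q \is Num.real by apply: rpred_sum => j _; rewrite realM.
have Gsw p q : G p q = G q p.
  by apply: eq_bigr => j _; rewrite (cyclotomic_sym p j cycA) (cyclotomic_sym j q cycA) mulrC.
have Gii : G i i = 4.
  by rewrite -E; apply: eq_bigr => j _; rewrite expr2 (cyclotomic_sym j i cycA).
have H (t : algC) : t \is Num.real -> 0 <= 4 - G k k - 2 * t * G i k.
  move=> tr; have xr (j : 'I_n) : t * (j == i)%:R + (j == k)%:R \is Num.real.
    by rewrite realD ?realM ?realn.
  have sumx (F : 'I_n -> algC) : \sum_j (t * (j == i)%:R + (j == k)%:R) * F j = t * F i + F k.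
    under eq_bigr do rewrite mulrDl -mulrA.
    by rewrite big_split -mulr_sumr /= !sum_indicator.
  have := cyclotomic_sum_ge0 cycA four_minus_sq_ge0 xr.
  rewrite !sumx !eqxx (eq_sym k) (negbTE ik) -!/(G _ _) Gii (Gsw k i).
  by congr (0 <= _); rewrite mulr1n mulr0n; ring.
change (G i k = 0); apply/eqP/negPn/negP => g0.
(* Since row i is full, the form at [t e_i + e_k] has no quadratic term in t; this t gives it the
   value -1. *)
have tr : (5 - G k k) / (2 * G i k) \is Num.real.
  by rewrite realM ?realV ?realB ?realM ?realn.
have := H _ tr.
have -> : 4 - G k k - 2 * ((5 - G k k) / (2 * G i k)) * G i k = -1 by field.
by rewrite ler0N1.
Qed.

Lemma s3_sq : s3 * s3 = 3.
Proof. by rewrite /s3 -expr2 sqrtCK. Qed.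

Lemma s3_gt0 : 0 < s3.
Proof. by rewrite sqrtC_gt0 ltr0n. Qed.

Lemma s3_real : s3 \is Num.real.
Proof. by rewrite realE ltW // s3_gt0. Qed.

(* sqrt 3 = +-i (w - w^2) for a primitive cube root of unity w, and z |-> z^5 on the 12th roots of
   unity fixes i and inverts w. *)
Lemma s3_conjugation : exists u : {rmorphism algC -> algC}, u s3 = - s3.
Proof.
have [u Hu] := @Qn_aut_exists 5 12 isT.
have [w [w3 ww]] : exists w : algC, w ^+ 3 = 1 /\ (w - w ^+ 2) ^+ 2 = -3.
  have [w wp] := C_prim_root_exists (isT : 0 < 3)%N.
  exists w; have w3 := prim_expr_order wp; split=> //.
  have w1 : w != 1 by have := prim_order_dvd wp 1; rewrite expr1 => <-.
  have w0 : w ^+ 2 + w + 1 = 0.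
    apply/eqP; have : (w - 1) * (w ^+ 2 + w + 1) == 0.
      have -> : (w - 1) * (w ^+ 2 + w + 1) = w ^+ 3 - 1 by ring.
      by rewrite w3 subrr.
    by rewrite mulf_eq0 subr_eq0 (negbTE w1).
  have -> : (w - w ^+ 2) ^+ 2 = w ^+ 2 - 2 * w ^+ 3 + w * w ^+ 3 by ring.
  rewrite w3; have -> : w ^+ 2 = - w - 1 by apply/eqP; rewrite -subr_eq0 -w0; apply/eqP; ring.
  ring.
have i12 : 'i ^+ 12 = 1 :> algC by rewrite (exprM _ 2 6) sqrCi -signr_odd.
have w12 : w ^+ 12 = 1 by rewrite (exprM _ 3 4) w3 expr1n.
have ui : u 'i = 'i by rewrite Hu // (exprD _ 4 1) (exprM _ 2 2) sqrCi sqrrN expr1n mul1r.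
have uw : u w = w ^+ 2 by rewrite Hu // (exprD _ 3 2) w3 mul1r.
exists u.
have : ('i * (w - w ^+ 2)) ^+ 2 == s3 ^+ 2.
  by rewrite exprMn sqrCi ww (expr2 s3) s3_sq mulN1r opprK.
have uE : u ('i * (w - w ^+ 2)) = - ('i * (w - w ^+ 2)).
  rewrite rmorphM ui rmorphB rmorphXn uw -exprM (exprD _ 3 1) w3 mul1r expr1; ring.
rewrite eqf_sqr => /orP[] /eqP E; move: uE; rewrite E // rmorphN opprK => us.
by apply: oppr_inj; rewrite us opprK.
Qed.

(** * Matrices over Z[sqrt 3] *)

(** The characteristic polynomial has integer coefficients, so u fixes it and the conjugate matrix
    has the same eigenvalues. *)
Lemma cyclotomic_conjugate n (A : 'M[algC]_n) (u : {rmorphism algC -> algC}) :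
  u s3 = - s3 -> Zs3_mx A -> cyclotomic A -> cyclotomic (map_mx u A).
Proof.
move=> us AZ [Areal Asym Achar Aeig].
have E : char_poly (map_mx u A) = char_poly A.
  rewrite -map_char_poly; apply/polyP => k; rewrite coef_map /=.
  by have /intrP[m ->] := Achar k; rewrite rmorph_int.
split.
- move=> i j; rewrite mxE; have [a [b ->]] := AZ i j.
  by rewrite rmorphD rmorphM !rmorph_int us realD ?realM ?realN ?s3_real // Rreal_int // intr_int.
- by apply/matrixP => i j; rewrite !mxE -{1}Asym mxE.
- by move=> k; rewrite E.
- by move=> z; rewrite eigenvalue_root_char E -eigenvalue_root_char; apply: Aeig.
Qed.

Lemma Zs3_eq0 (a b : int) : a%:~R + b%:~R * s3 = 0 -> a = 0 /\ b = 0.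
Proof.
move=> E; have [u us] := s3_conjugation.
have E' : a%:~R - b%:~R * s3 = 0 :> algC.
  by rewrite -[RHS](rmorph0 u) -E rmorphD rmorphM !rmorph_int us mulrN.
have a0 : a = 0.
  have : 2 * a%:~R == 0 :> algC by rewrite -[0]addr0 -{1}E -E'; apply/eqP; ring.
  by rewrite mulf_eq0 pnatr_eq0 intr_eq0 => /eqP.
split=> //; move: E; rewrite a0 add0r; move => /eqP; by rewrite mulf_eq0 (gt_eqF s3_gt0) orbF intr_eq0 => /eqP.
Qed.

Section Zs3Matrix.

Variables (n : nat) (A : 'M[algC]_n) (X Y : 'I_n -> 'I_n -> int).
Hypothesis AE : forall i j, A i j = (X i j)%:~R + (Y i j)%:~R * s3.
Hypothesis cycA : cyclotomic A.

(** The mean of the squares of the entry and of its conjugate; averaging the two row bounds gives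
    [weight_sum]. *)
Definition weight i j : int := X i j ^+ 2 + 3 * Y i j ^+ 2.

Lemma coordinates_Zs3 : Zs3_mx A.
Proof. by move=> i j; exists (X i j), (Y i j). Qed.

Lemma conjugate_gram_bound i : \sum_j ((X i j)%:~R - (Y i j)%:~R * s3) ^+ 2 <= 4.
Proof.
have [u us] := s3_conjugation.
have := gram_bound i (cyclotomic_conjugate us coordinates_Zs3 cycA).
by under eq_bigr do rewrite mxE AE rmorphD rmorphM !rmorph_int us mulrN.
Qed.

Lemma weight_sum i : \sum_j weight i j <= 4.
Proof.
have H1 := gram_bound i cycA; have H2 := conjugate_gram_bound i.
have : 2 * (\sum_j weight i j)%:~R <= 2 * 4 :> algC.
  rewrite -[leRHS]/(2 * 4) [leRHS](_ : _ = 4 + 4); last by ring.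
  apply: le_trans (lerD H1 H2); rewrite rmorph_sum mulr_sumr -big_split /=.
  rewrite le_eqVlt; apply/orP; left; apply/eqP; apply: eq_bigr => j _.
  rewrite AE rmorphD rmorphM ?rmorphXn /=.
  by have := s3_sq; move: s3 => s ss; ring: ss.
by rewrite ler_pM2l ?ltr0n // -[4]/(4%:~R) ler_int.
Qed.

Lemma weight_ge0 i j : 0 <= weight i j.
Proof. by rewrite /weight; nia. Qed.

(** The squares of the entry and of its conjugate are [weight] plus and minus 2 X Y sqrt 3, and
    neither exceeds 4. If X and Y were both nonzero, [weight] would already be at least 4, leaving
    no room for the irrational term. *)
Lemma XY_eq0 i j : X i j * Y i j = 0.
Proof.
have sqle (F : 'I_n -> algC) : (forall j, F j \is Num.real) -> \sum_j F j ^+ 2 <= 4 -> F j ^+ 2 <= 4.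
  move=> Fr; apply: le_trans; rewrite (bigD1 j) //= lerDl sumr_ge0 // => k _.
  by rewrite -realEsqr.
have intr_real (m : int) : m%:~R \is @Num.real algC by rewrite Rreal_int // intr_int.
have H1 := sqle _ (fun j => let: And4 r _ _ _ := cycA in r i j) (gram_bound i cycA).
have H2 : ((X i j)%:~R - (Y i j)%:~R * s3) ^+ 2 <= 4.
  by apply: (sqle (fun j => (X i j)%:~R - (Y i j)%:~R * s3)) (conjugate_gram_bound i) => k;
    rewrite realB ?realM ?s3_real.
rewrite AE in H1; apply/eqP/negPn/negP => xy0.
have w4 : 4 <= weight i j by rewrite /weight; nia.
have {}w4 : 4 <= (weight i j)%:~R :> algC by rewrite -[4]/(4%:~R) ler_int.
have e1 : ((X i j)%:~R + (Y i j)%:~R * s3) ^+ 2 = (weight i j)%:~R + 2 * (X i j * Y i j)%:~R * s3.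
  by rewrite /weight rmorphD !rmorphM ?rmorphXn /=; have := s3_sq; move: s3 => s ss; ring: ss.
have e2 : ((X i j)%:~R - (Y i j)%:~R * s3) ^+ 2 = (weight i j)%:~R - 2 * (X i j * Y i j)%:~R * s3.
  by rewrite /weight rmorphD !rmorphM ?rmorphXn /=; have := s3_sq; move: s3 => s ss; ring: ss.
rewrite e1 in H1; rewrite e2 in H2.
have H3 : 2 * (X i j * Y i j)%:~R * s3 <= 0.
  by rewrite -(lerD2l (weight i j)%:~R) addr0; apply: le_trans w4.
have H4 : 2 * (X i j * Y i j)%:~R * s3 >= 0.
  by rewrite -oppr_le0 -(lerD2l (weight i j)%:~R) addr0; apply: le_trans w4.
have : 2 * (X i j * Y i j)%:~R * s3 == 0 by rewrite eq_le H3 H4.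
by rewrite !mulf_eq0 (gt_eqF s3_gt0) pnatr_eq0 intr_eq0 /= orbF; apply/negP.
Qed.

Lemma entry_sq i j : A i j ^+ 2 = (weight i j)%:~R.
Proof.
rewrite AE; transitivity ((weight i j)%:~R + 2 * (X i j * Y i j)%:~R * s3); last first.
  by rewrite XY_eq0 mulr0 mul0r addr0.
by rewrite /weight rmorphD !rmorphM ?rmorphXn /=; have := s3_sq; move: s3 => s ss; ring: ss.
Qed.

Lemma weight_eq0 i j : (weight i j == 0) = (A i j == 0).
Proof. by rewrite -(intr_eq0 algC) -entry_sq sqrf_eq0. Qed.

Lemma weight_sym i j : weight i j = weight j i.
Proof. by apply: (@intr_inj algC); rewrite -!entry_sq (cyclotomic_sym i j cycA). Qed.

Lemma weight1 i j : weight i j = 1 -> A i j = 1 \/ A i j = -1.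
Proof.
move=> w1; have := entry_sq i j; rewrite w1 => /eqP; rewrite sqrf_eq1.
by case/orP => /eqP; [left|right].
Qed.

Lemma weight3 i j : weight i j = 3 -> A i j = s3 \/ A i j = - s3.
Proof.
move=> w3; have /eqP := entry_sq i j; rewrite w3 -[3%:~R]/(3 : algC) -s3_sq -expr2 eqf_sqr.
by case/orP => /eqP; [left|right].
Qed.

Lemma weight_cases i j : [\/ weight i j = 0, weight i j = 1, weight i j = 3 | weight i j = 4].
Proof.
have w4 : weight i j <= 4.
  apply: le_trans (weight_sum i); rewrite (bigD1 j) //= lerDl sumr_ge0 // => k _.
  exact: weight_ge0.
have := XY_eq0 i j; move: w4; rewrite /weight => w4 xy.
have [x0|y0] : X i j = 0 \/ Y i j = 0 by nia.
  have [y0|y1] : Y i j = 0 \/ Y i j ^+ 2 = 1 by nia.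
    by constructor 1; rewrite x0 y0.
  by constructor 3; rewrite x0 y1.
have xb : -2 <= X i j <= 2 by rewrite y0 in w4; nia.
have [x0|[x1|x2]] : X i j = 0 \/ X i j ^+ 2 = 1 \/ X i j ^+ 2 = 4.
  have : X i j = 0 \/ (X i j = 1 \/ X i j = -1) \/ (X i j = 2 \/ X i j = -2) by lia.
  by case=> [->|[[]->|[]->]]; [left|right;left|right;left|right;right|right;right].
- by constructor 1; rewrite x0 y0.
- by constructor 2; rewrite x1 y0.
- by constructor 4; rewrite x2 y0.
Qed.

Lemma weight2_le i p q : p != q -> weight i p + weight i q <= 4.
Proof.
move=> pq; apply: le_trans (weight_sum i); rewrite (bigD1 p) //= (bigD1 q) 1?eq_sym //=.
by rewrite addrA lerDl sumr_ge0 // => k _; exact: weight_ge0.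
Qed.

Lemma weight3_le i p q r : p != q -> p != r -> q != r -> weight i p + weight i q + weight i r <= 4.
Proof.
move=> pq pr qr; apply: le_trans (weight_sum i); rewrite (bigD1 p) //= (bigD1 q) 1?eq_sym //=.
rewrite (bigD1 r) /=; last by rewrite (eq_sym r) pr (eq_sym r) qr.
by rewrite !addrA lerDl sumr_ge0 // => k _; exact: weight_ge0.
Qed.

Lemma full_row i p q : p != q -> weight i p + weight i q = 4 ->
  (forall m, m != p -> m != q -> A i m = 0) /\
  (forall k, i != k -> A i p * A p k + A i q * A q k = 0).
Proof.
move=> pq w4; have zero m : m != p -> m != q -> A i m = 0.
  move=> mp mq; apply/eqP; rewrite -weight_eq0.
  have := @weight3_le i p q m pq; rewrite (eq_sym p) (eq_sym q) mp mq => /(_ isT isT).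
  by have := weight_ge0 i m; lia.
split=> // k ik.
have two (F : 'I_n -> algC) : (forall m, m != p -> m != q -> F m = 0) -> \sum_j F j = F p + F q.
  move=> F0; rewrite (bigD1 p) //= (bigD1 q) 1?eq_sym //= big1 ?addr0 // => m /andP[mp mq].
  exact: F0.
rewrite -(two (fun j => A i j * A j k)) => [|m mp mq]; last by rewrite zero ?mul0r.
apply: gram_orthogonal => //; rewrite (two (fun j => A i j ^+ 2)) => [|m mp mq].
  by rewrite !entry_sq -rmorphD w4.
by rewrite zero ?expr0n.
Qed.

(** * Matrices with an irrational entry *)

Hypothesis indecA : indecomposable A.

Lemma indecomposable_closed (P : 'I_n -> Prop) i : P i ->
  (forall x y, P x -> A x y != 0 -> P y) -> forall v, P v.
Proof.
move=> Pi Pstep v; have /connectP[s] := indecA i v.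
elim: s i Pi => [|x s IH] u Pu /=; first by move=> _ ->.
by move=> /andP[/andP[_ ux] pth]; apply: IH => //; apply: Pstep ux.
Qed.

Lemma entry_sym i j : A i j = A j i.
Proof. exact: cyclotomic_sym. Qed.

Lemma entry_neq0_weight i j w : weight i j = w -> w != 0 -> A i j != 0.
Proof. by move=> <-; rewrite weight_eq0. Qed.

Definition sub_signed m (B : 'M[algC]_m) : Prop :=
  exists (p : 'I_n -> 'I_m) (s : 'I_n -> bool), injective p /\
    forall i j, A i j = (-1) ^+ s i * (-1) ^+ s j * B (p i) (p j).

Lemma two_vertices (B : 'M[algC]_2) i j (b : bool) : i != j -> (forall v, v = i \/ v = j) ->
  A i i = B 0 0 -> A j j = B 1 1 -> A i j = (-1) ^+ b * B 0 1 -> A j i = (-1) ^+ b * B 1 0 ->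
  sub_signed B.
Proof.
move=> ij all_v Aii Ajj Aij Aji.
exists (fun v => if v == i then 0 else 1), (fun v => (v != i) && b); split.
  move=> x y; have [->|->] := all_v x; have [->|->] := all_v y;
    by rewrite ?eqxx // (eq_sym j) (negbTE ij).
move=> x y; have [->|->] := all_v x; have [->|->] := all_v y;
  rewrite ?eqxx 1?(eq_sym j) ?(negbTE ij) /= ?expr0 ?mul1r ?mulr1 //.
by rewrite -expr2 sqrr_sign mul1r.
Qed.

Lemma sign_of (x : algC) c : x = c \/ x = - c -> exists b : bool, x = (-1) ^+ b * c.
Proof. by case=> ->; [exists false|exists true]; rewrite /= ?expr0 ?expr1 ?mulN1r ?mul1r. Qed.

Lemma two_row_closed i j : i != j -> weight i i + weight i j = 4 -> weight j i + weight j j = 4 ->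
  forall v, v = i \/ v = j.
Proof.
move=> ij wi wj; apply: (@indecomposable_closed _ i); first by left.
have [zi _] := full_row ij wi; have [zj _] := full_row ij wj.
move=> x y Px; have [yi|yi] := eqVneq y i; first by left.
have [yj|yj] := eqVneq y j; first by right.
by case: Px => ->; rewrite ?zi ?zj ?eqxx.
Qed.

Lemma opposite_charges i j : i != j -> A i j != 0 -> weight i i + weight i j = 4 -> A j j = - A i i.
Proof.
move=> ij aij wi; have [_ /(_ j ij) E] := full_row ij wi.
by apply/eqP; rewrite -addr_eq0 addrC; move/eqP: E; rewrite [A i i * _]mulrC -mulrDr mulf_eq0 (negbTE aij).
Qed.

Lemma opposite_weight i j : A j j = - A i i -> weight j j = weight i i.
Proof. by move=> E; apply: (@intr_inj algC); rewrite -!entry_sq E sqrrN. Qed.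

Lemma S2'E : [/\ S2' 0 0 = s3, S2' 1 1 = - s3, S2' 0 1 = 1 & S2' 1 0 = 1].
Proof. by split; rewrite mxE. Qed.

Lemma S2dagE : [/\ S2dag 0 0 = 1, S2dag 1 1 = -1, S2dag 0 1 = s3 & S2dag 1 0 = s3].
Proof. by split; rewrite mxE. Qed.

(** Excludes the 1 by 1 matrices with entry sqrt 3 or -sqrt 3, whose eigenvalue lies in [-2, 2] but
    whose characteristic polynomial is not integral. *)
Lemma singleton_integral i : (forall v, v = i) -> A i i \is a Num.int.
Proof.
move=> all_i; have [_ _ Hc _] := cycA; have := Hc 0%N.
rewrite char_poly_det rpredMsign; suff -> : \det A = A i i by [].
have n1 : n = 1%N by rewrite -[n]card_ord; apply/eqP/fintype1P; exists i => v; rewrite (all_i v).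
clear - n1 all_i; move: A i all_i; rewrite n1 => A' i _.
by rewrite det_mx11 (ord1 i).
Qed.

Lemma s3_not_integral : s3 \isn't a Num.int.
Proof.
apply/negP => /intrP[m E]; have [|//] := @Zs3_eq0 (- m) 1.
by rewrite mul1r E rmorphN addNr.
Qed.

Lemma charged_sqrt3 i : weight i i = 3 -> sub_signed S2'.
Proof.
move=> wii; have [[j [ij aij]]|no] := classic (exists j, i != j /\ A i j != 0); last first.
  have /singleton_integral : forall v, v = i.
    apply: (@indecomposable_closed _ i) => // x y -> xy; apply/eqP/negPn/negP => yi.
    by apply: no; exists y; rewrite eq_sym.
  by have [->|->] := weight3 wii; rewrite ?rpredN (negbTE s3_not_integral).
have wij : weight i j = 1.
  have := weight2_le i ij; rewrite wii => w4; have := weight_ge0 i j.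
  by move: aij; rewrite -weight_eq0; lia.
have wi : weight i i + weight i j = 4 by rewrite wii wij.
have E := opposite_charges ij aij wi; have wjj := opposite_weight E.
have wj : weight j i + weight j j = 4 by rewrite wjj weight_sym wii wij.
have all_v := two_row_closed ij wi wj.
have [b Eb] := sign_of (weight1 wij).
have [e00 e11 e01 e10] := S2'E.
have [Aii|Aii] := weight3 wii.
  by apply: (two_vertices (b := b) ij all_v); rewrite ?e00 ?e11 ?e01 ?e10 ?E ?Aii // entry_sym.
have all_v' v : v = j \/ v = i by have [] := all_v v; [right|left].
rewrite eq_sym in ij.
by apply: (two_vertices (b := b) ij all_v'); rewrite ?e00 ?e11 ?e01 ?e10 ?E ?Aii ?opprK // entry_sym.
Qed.

Lemma charged_sqrt3_edge i j : i != j -> weight i j = 3 -> A i i != 0 -> sub_signed S2dag.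
Proof.
move=> ij wij aii.
have aij : A i j != 0 by apply: entry_neq0_weight wij _.
have wii : weight i i = 1.
  have := weight2_le i ij; rewrite wij => w4; have := weight_ge0 i i.
  by move: aii; rewrite -weight_eq0; lia.
have wi : weight i i + weight i j = 4 by rewrite wii wij.
have E := opposite_charges ij aij wi; have wjj := opposite_weight E.
have wj : weight j i + weight j j = 4 by rewrite wjj weight_sym wii wij.
have all_v := two_row_closed ij wi wj.
have [b Eb] := sign_of (weight3 wij).
have [e00 e11 e01 e10] := S2dagE.
have [Aii|Aii] := weight1 wii.
  by apply: (two_vertices (b := b) ij all_v); rewrite ?e00 ?e11 ?e01 ?e10 ?E ?Aii // entry_sym.
have all_v' v : v = j \/ v = i by have [] := all_v v; [right|left].
rewrite eq_sym in ij.
by apply: (two_vertices (b := b) ij all_v'); rewrite ?e00 ?e11 ?e01 ?e10 ?E ?Aii ?opprK // entry_sym.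
Qed.

(** Row i is filled by the weights 3 and 1. Orthogonality to row j, where j is uncharged, gives
    [A j v = 0], and then orthogonality to row v gives [A v v = 0]. *)
Lemma sqrt3_edge_neighbour i j v : i != j -> weight i j = 3 -> A j j = 0 -> v != j -> A i v != 0 ->
  v != i -> [/\ weight i v = 1, forall m, m != j -> m != v -> A i m = 0, A j v = 0, A v v = 0 &
    forall x, x != i -> A i j * A j x + A i v * A v x = 0].
Proof.
move=> ij wij ajj vj aiv vi.
have jv : j != v by rewrite eq_sym.
have wiv : weight i v = 1.
  have := weight2_le i jv; rewrite wij => w4; have := weight_ge0 i v.
  by move: aiv; rewrite -weight_eq0; lia.
have [zero orth] := full_row jv (etrans (congr2 _ wij wiv) erefl : weight i j + weight i v = 4).
have ajv : A j v = 0.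
  by have /eqP := orth j ij; rewrite ajj mulr0 add0r mulf_eq0 (negbTE aiv) entry_sym => /eqP.
split=> //; last by move=> x xi; apply: orth; rewrite eq_sym.
have iv : i != v by rewrite eq_sym.
have /eqP := orth v iv; by rewrite ajv mulr0 add0r mulf_eq0 (negbTE aiv) => /eqP.
Qed.

Lemma uncharged_sqrt3_edge i j : i != j -> weight i j = 3 -> A i i = 0 -> A j j = 0 ->
  sub_signed S4s3.
Proof.
move=> ij wij aii ajj.
have ji : j != i by rewrite eq_sym.
have wji : weight j i = 3 by rewrite weight_sym.
have [sj Esj] := sign_of (weight3 wij).
(* No vertex is farther away: if x is a neighbour of i and y a further neighbour of x, orthogonality
   of rows i and y forces y to be adjacent to j as well, and symmetrically. *)
have cover v : [\/ v = i, v = j, A i v != 0 | A j v != 0].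
  move: v; apply: (@indecomposable_closed _ i); first by constructor 1.
  move=> x y Px xy; have [->|yi] := eqVneq y i; first by constructor 1.
  have [->|yj] := eqVneq y j; first by constructor 2.
  have [xi|xi] := eqVneq x i; first by constructor 3; rewrite -xi.
  have [xj|xj] := eqVneq x j; first by constructor 4; rewrite -xj.
  case: Px => [/eqP|/eqP|aix|ajx]; rewrite ?(negbTE xi) ?(negbTE xj) //.
    have [_ _ _ _ /(_ y yi) E] := sqrt3_edge_neighbour ij wij ajj xj aix xi.
    constructor 4; apply/negP => /eqP ajy; move/eqP: E.
    by rewrite ajy mulr0 add0r mulf_eq0 (negbTE aix) (negbTE xy).
  have [_ _ _ _ /(_ y yj) E] := sqrt3_edge_neighbour ji wji aii xi ajx xj.
  constructor 3; apply/negP => /eqP aiy; move/eqP: E.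
  by rewrite aiy mulr0 add0r mulf_eq0 (negbTE ajx) (negbTE xy).
(* The vertices i and j become a and b; a further neighbour of i becomes c and one of j becomes d,
   either of which may be missing. The sign of each vertex is forced by its edge to i or j. *)
have [p [s Hps]] : exists (p : 'I_n -> 'I_4) (s : 'I_n -> bool), forall v,
   [\/ [/\ v = i, p v = 0 & s v = false], [/\ v = j, p v = 1 & s v = sj],
       [/\ v != i, v != j, A i v = - (-1) ^+ s v & p v = 2] |
       [/\ v != i, v != j, A j v = (-1) ^+ sj * (-1) ^+ s v & p v = 3]].
  have [F HF] : exists F : 'I_n -> 'I_4 * bool, forall v,
   [\/ [/\ v = i, (F v).1 = 0 & (F v).2 = false], [/\ v = j, (F v).1 = 1 & (F v).2 = sj],
       [/\ v != i, v != j, A i v = - (-1) ^+ (F v).2 & (F v).1 = 2] |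
       [/\ v != i, v != j, A j v = (-1) ^+ sj * (-1) ^+ (F v).2 & (F v).1 = 3]].
    apply: (@fin_all_exists _ (fun=> ('I_4 * bool)%type) (fun v t =>
      [\/ [/\ v = i, t.1 = 0 & t.2 = false], [/\ v = j, t.1 = 1 & t.2 = sj],
       [/\ v != i, v != j, A i v = - (-1) ^+ t.2 & t.1 = 2] |
       [/\ v != i, v != j, A j v = (-1) ^+ sj * (-1) ^+ t.2 & t.1 = 3]])) => v.
    have [->|vi] := eqVneq v i; first by exists (0, false); constructor 1.
    have [->|vj] := eqVneq v j; first by exists (1, sj); constructor 2.
    have [/eqP|/eqP|aiv|ajv] := cover v; rewrite ?(negbTE vi) ?(negbTE vj) //.
      have [wv _ _ _ _] := sqrt3_edge_neighbour ij wij ajj vj aiv vi.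
      have [b Eb] := sign_of (weight1 wv).
      by exists (2, ~~ b); constructor 3; split=> //=; rewrite Eb mulr1; case: (b); rewrite /= ?expr0 ?expr1 ?opprK.
    have [wv _ _ _ _] := sqrt3_edge_neighbour ji wji aii vi ajv vj.
    have [b Eb] := sign_of (weight1 wv).
    exists (3, b (+) sj); constructor 4; split=> //=; rewrite Eb mulr1 signr_addb mulrCA -expr2.
    by rewrite sqrr_sign mulr1.
  by exists (fun v => (F v).1), (fun v => (F v).2).
have sq (b : bool) : (-1) ^+ b * (-1) ^+ b = 1 :> algC by rewrite -expr2 sqrr_sign.
have sneq (b : bool) : (-1) ^+ b != 0 :> algC by rewrite signr_eq0.
have class2 v : v != i -> v != j -> A i v = - (-1) ^+ s v ->
    [/\ forall m, m != j -> m != v -> A i m = 0, A j v = 0, A v v = 0 &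
        forall x, x != i -> A v x = (-1) ^+ s v * (-1) ^+ sj * s3 * A j x].
  move=> vi vj E; have aiv : A i v != 0 by rewrite E oppr_eq0.
  have [_ H1 H2 H3 H4] := sqrt3_edge_neighbour ij wij ajj vj aiv vi; split=> // x xi.
  have := H4 x xi; rewrite E Esj mulNr => /eqP; rewrite subr_eq0 => /eqP Ex.
  transitivity ((-1) ^+ s v * ((-1) ^+ sj * s3 * A j x)); last by rewrite !mulrA.
  by rewrite Ex mulrA sq mul1r.
have class3 v : v != i -> v != j -> A j v = (-1) ^+ sj * (-1) ^+ s v ->
    [/\ forall m, m != i -> m != v -> A j m = 0, A i v = 0 &
        forall x, x != j -> A i x = 0 -> A v x = 0].
  move=> vi vj E; have ajv : A j v != 0 by rewrite E mulf_neq0.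
  have [_ H1 H2 H3 H4] := sqrt3_edge_neighbour ji wji aii vi ajv vj; split=> // x xj aix.
  have /eqP := H4 x xj; by rewrite aix mulr0 add0r mulf_eq0 (negbTE ajv) => /eqP.
exists p, s; split=> [x y pxy|x y].
  have [[xE px _]|[xE px _]|[xi xj Ex px]|[xi xj Ex px]] := Hps x;
  have [[yE py _]|[yE py _]|[yi yj Ey py]|[yi yj Ey py]] := Hps y;
    try by [rewrite xE yE | move: pxy; rewrite px py => /(congr1 (@nat_of_ord 4))].
  - have [H1 _ _ _] := class2 x xi xj Ex; apply/eqP/negPn/negP; rewrite eq_sym => yx.
    by move: Ey; rewrite (H1 y yj yx) => /esym/eqP; rewrite oppr_eq0 (negbTE (sneq _)).
  - have [H1 _ _] := class3 x xi xj Ex; apply/eqP/negPn/negP; rewrite eq_sym => yx.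
    by move: Ey; rewrite (H1 y yi yx) => /esym/eqP; rewrite mulf_eq0 !(negbTE (sneq _)).
have [[xE px sx]|[xE px sx]|[xi xj Ex px]|[xi xj Ex px]] := Hps x;
have [[yE py sy]|[yE py sy]|[yi yj Ey py]|[yi yj Ey py]] := Hps y;
  rewrite px py mxE /tbl /=.
- by rewrite xE yE aii mulr0.
- by rewrite sx sy xE yE Esj mul1r.
- by rewrite sx xE Ey mul1r mulrN1.
- by rewrite xE; have [_ -> _] := class3 y yi yj Ey; rewrite mulr0.
- by rewrite sx sy xE yE entry_sym Esj mulr1.
- by rewrite xE yE ajj mulr0.
- by rewrite xE; have [_ -> _ _] := class2 y yi yj Ey; rewrite mulr0.
- by rewrite sx xE Ey mulr1.
- by rewrite sy yE entry_sym Ex mulr1 mulrN1.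
- by rewrite yE entry_sym; have [_ -> _ _] := class2 x xi xj Ex; rewrite mulr0.
- have [_ _ _ ->] := class2 x xi xj Ex; last by [].
  by have [_ -> _ _] := class2 y yi yj Ey; rewrite !mulr0.
- have [_ _ _ ->] := class2 x xi xj Ex; last by [].
  transitivity ((-1) ^+ sj * (-1) ^+ sj * ((-1) ^+ s x * (-1) ^+ s y * s3)); first by rewrite Ey; ring.
  by rewrite sq mul1r.
- by rewrite yE entry_sym; have [_ -> _] := class3 x xi xj Ex; rewrite mulr0.
- by rewrite sy yE entry_sym Ex mulr1 mulrC.
- rewrite entry_sym; have [_ _ _ ->] := class2 y yi yj Ey; last by [].
  transitivity ((-1) ^+ sj * (-1) ^+ sj * ((-1) ^+ s x * (-1) ^+ s y * s3)); first by rewrite Ex; ring.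
  by rewrite sq mul1r.
- have [_ aiy _] := class3 y yi yj Ey.
  by have [_ _ ->] := class3 x xi xj Ex; rewrite ?mulr0.
Qed.

Theorem non_integral_sub_signed : ~ Z_mx A ->
  [\/ sub_signed S2', sub_signed S2dag | sub_signed S4s3].
Proof.
move=> nZ; have [i [j yij]] : exists i j, Y i j != 0.
  apply: NNPP => no; apply: nZ => i j; exists (X i j).
  suff -> : A i j = (X i j)%:~R + 0 by rewrite addr0.
  rewrite AE; suff -> : Y i j = 0 by rewrite mul0r.
  by apply/eqP/negPn/negP => h; apply: no; exists i, j.
have wij : weight i j = 3.
  have xy := XY_eq0 i j; have x0 : X i j = 0.
    by apply/eqP; move/eqP: xy; rewrite mulf_eq0 (negbTE yij) orbF.
  have := weight_cases i j; rewrite /weight x0.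
  by case=> E //; nia.
have [ij|ij] := eqVneq i j; first by constructor 1; apply: (charged_sqrt3 (i := i)); rewrite {2}ij.
have [aii|aii] := eqVneq (A i i) 0; last by constructor 2; apply: charged_sqrt3_edge wij aii.
have [ajj|ajj] := eqVneq (A j j) 0; first by constructor 3; apply: uncharged_sqrt3_edge wij aii ajj.
constructor 2; apply: (charged_sqrt3_edge (i := j) (j := i)) => //; first by rewrite eq_sym.
by rewrite weight_sym.
Qed.

End Zs3Matrix.

(** * Matrices of square 4 and the theorem *)

Definition complete_mx n (M : 'M[algC]_n) : Prop :=
  [/\ Zs3_mx M, indecomposable M, M^T = M & M *m M = 4%:M].

Lemma complete_eigenvalue n (M : 'M[algC]_n) z : M *m M = 4%:M -> eigenvalue M z -> z = 2 \/ z = -2.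
Proof.
move=> MM /eigenvalueP[v vM v0].
have : (z ^+ 2 - 4) *: v == 0.
  rewrite scalerBl expr2 -scalerA -vM scalemxAl -vM -mulmxA MM mul_mx_scalar.
  by rewrite subrr.
rewrite scaler_eq0 (negbTE v0) orbF.
have -> : z ^+ 2 - 4 = (z - 2) * (z + 2) by ring.
by rewrite mulf_eq0 subr_eq0 addr_eq0 => /orP[] /eqP; [left|right].
Qed.

Lemma complete_indec_cyc n (M : 'M[algC]_n) : complete_mx M -> indec_cyc_Zs3 M.
Proof.
move=> [MZ Mi Msym MM]; split=> //; split=> //.
- move=> i j; have [a [b ->]] := MZ i j.
  by rewrite realD ?realM ?s3_real // Rreal_int // intr_int.
- have [r Er] := closed_field_poly_normal (char_poly M).
  rewrite (monicP (char_poly_monic M)) scale1r in Er.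
  have rint z : z \in r -> z \is a Num.int.
    move=> zr; have : root (char_poly M) z by rewrite Er root_prod_XsubC.
    by rewrite -eigenvalue_root_char => /(complete_eigenvalue MM)[] ->; rewrite ?rpredN rpred_nat.
  rewrite Er; elim: r rint {Er} => [|z r IH] rint k.
    by rewrite big_nil coef1 rpred_nat.
  have {}IH := IH (fun y yr => rint y (mem_behead (s := z :: r) yr)).
  rewrite big_cons mulrBl coefB coefXM coefCM rpredB ?rpredM ?IH ?(rint z (mem_head z r)) //.
  by case: ifP => _; rewrite ?rpred0 ?IH.
- move=> z /(complete_eigenvalue MM)[] ->; rewrite lexx ?andbT //=.
    by rewrite (@le_trans _ _ 0) // ?oppr_le0 ler0n.
  by rewrite (@le_trans _ _ 0) // ?oppr_le0 ler0n.
Qed.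

(** The rows of M have square sum 4, so an extension has no edge leaving the image of f, and
    connectedness makes f onto. The empty matrix must be excluded: it has square 4 vacuously but is
    not maximal. *)
Lemma complete_maximal n (M : 'M[algC]_n) : (0 < n)%N -> complete_mx M -> maximal_indec_cyc_Zs3 M.
Proof.
move=> n0 cM; split; first exact: complete_indec_cyc.
have [MZ Mi Msym MM] := cM.
move=> [m [B [nm [[BZ Bi cycB] [f [finj fB]]]]]].
have im v : exists i, f i = v.
  move: v; apply: (@indecomposable_closed _ _ Bi _ (f (Ordinal n0))); first by exists (Ordinal n0).
  move=> _ y [i <-] By; apply: NNPP => no.
  have yi : y \notin f @: setT by apply/imsetP => -[j _ jy]; apply: no; exists j.
  have Breal k : 0 <= B (f i) k ^+ 2 by rewrite -realEsqr; case: cycB.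
  have := gram_bound (f i) cycB; rewrite (bigID (mem (f @: setT))) /=.
  rewrite big_imset /=; last by move=> ? ? _ _; apply: finj.
  have -> : \sum_(j in setT) B (f i) (f j) ^+ 2 = 4.
    have /matrixP/(_ i i) := MM; rewrite !mxE eqxx mulr1n => <-.
    by apply: eq_big => [j|j _]; rewrite ?inE // -fB expr2 -{2}Msym mxE.
  rewrite (bigD1 y) //= gerDl => H.
  have : 0 < B (f i) y ^+ 2 + \sum_(k | (k \notin f @: setT) && (k != y)) B (f i) k ^+ 2.
    by rewrite ltr_pwDl ?sumr_ge0 // lt_neqAle Breal andbT eq_sym expf_neq0.
  by move=> /lt_le_trans /(_ H); rewrite ltxx.
have := leq_imset_card f setT.
have -> : f @: setT = setT by apply/setP => v; rewrite inE; have [i <-] := im v; apply: imset_f.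
by rewrite !cardsT !card_ord leqNgt nm.
Qed.

(** Since [principal_sub] asks for equal entries, the signs are moved from A to S; this preserves
    symmetry, the square and connectedness. *)
Lemma sub_signed_complete n m (A : 'M[algC]_n) (S : 'M[algC]_m) :
  complete_mx S -> sub_signed A S -> exists S' : 'M[algC]_m, complete_mx S' /\ principal_sub A S'.
Proof.
move=> [SZ Si Ssym SS] [p [s [pinj Ap]]].
pose r v := if [pick i | p i == v] is Some i then s i else false.
have rp i : r (p i) = s i.
  by rewrite /r; case: pickP => [j /eqP /pinj ->|/(_ i)] //; rewrite eqxx.
pose S' : 'M[algC]_m := \matrix_(u, v) ((-1) ^+ r u * (-1) ^+ r v * S u v).
exists S'; split; last by exists p; split=> // i j; rewrite mxE !rp.
split.
- move=> u v; rewrite mxE; have [a [b ->]] := SZ u v.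
  exists ((-1) ^+ r u * (-1) ^+ r v * a), ((-1) ^+ r u * (-1) ^+ r v * b).
  by rewrite !rmorphM !rmorph_sign mulrDr !mulrA.
- move=> u v; have := Si u v; apply: connect_sub => x y /andP[xy Sxy].
  by apply: connect1; rewrite /adj_rel xy mxE !mulf_neq0 ?signr_eq0.
- by apply/matrixP => u v; rewrite !mxE -{1}Ssym mxE (mulrC (_ ^+ r u)).
- apply/matrixP => u v; rewrite mxE.
  transitivity ((-1) ^+ r u * (-1) ^+ r v * (S *m S) u v).
    rewrite mxE mulr_sumr; apply: eq_bigr => k _; rewrite !mxE.
    transitivity ((-1) ^+ r k * (-1) ^+ r k * ((-1) ^+ r u * (-1) ^+ r v * (S u k * S k v)));
      last by rewrite -expr2 sqrr_sign mul1r.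
    by move: (_ ^+ r u) (_ ^+ r v) (_ ^+ r k) => a b c; ring.
  rewrite SS !mxE; case: eqP => [->|_]; last by rewrite !mulr0n mulr0.
  by rewrite -expr2 sqrr_sign mul1r.
Qed.

Lemma sub_signed_equiv n (A S : 'M[algC]_n) : Zs3_mx A -> sub_signed A S -> equiv_mx A S.
Proof.
move=> AZ [p [s [pinj Ap]]]; left.
pose Q : 'M[algC]_n := \matrix_(i, j) (if p i == j then (-1) ^+ s i else 0).
exists Q, false; split; first by exists p, s; split=> //; apply: injF_bij.
have QE i (F : 'I_n -> algC) : \sum_k Q i k * F k = (-1) ^+ s i * F (p i).
  rewrite (bigD1 (p i)) //= mxE eqxx big1 ?addr0 // => k kp.
  by rewrite mxE eq_sym (negbTE kp) mul0r.
have QSQ i j : (Q *m S *m Q^T) i j = A i j.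
  rewrite Ap mxE; under eq_bigr do rewrite [Q^T _ _]mxE mulrC.
  by rewrite QE mxE QE mulrCA mulrA.
move=> i j; rewrite QSQ; have [a [b ->]] := AZ i j.
by exists a%:~R, b%:~R; rewrite !ratr_int expr0 mul1r.
Qed.

Lemma ord2P (P : 'I_2 -> Prop) : P 0 -> P 1 -> forall i, P i.
Proof.
move=> P0 P1 [[|[|//]] Hi].
  by have -> : Ordinal Hi = 0 by apply: val_inj.
by have -> : Ordinal Hi = 1 by apply: val_inj.
Qed.

Lemma inZs3_int (m : int) : inZs3 m%:~R.
Proof. by exists m, 0; rewrite mul0r addr0. Qed.

Lemma inZs3_s3 (m : int) : inZs3 (m%:~R * s3).
Proof. by exists 0, m; rewrite add0r. Qed.

Lemma inZs3_entry (x : algC) : x \in [:: 0; 1; -1; s3; - s3] -> inZs3 x.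
Proof.
rewrite !inE => /or4P[|||/orP[]] /eqP ->.
- exact: (inZs3_int 0).
- exact: (inZs3_int 1).
- exact: (inZs3_int (-1)).
- by have := inZs3_s3 1; rewrite mul1r.
- by have := inZs3_s3 (-1); rewrite mulN1r.
Qed.

Lemma s3_neq0 : s3 != 0.
Proof. by rewrite gt_eqF ?s3_gt0. Qed.

Lemma S2'_complete : complete_mx S2'.
Proof.
split.
- by do 2!elim/ord2P; apply: inZs3_entry; rewrite mxE /tbl /= !inE eqxx ?orbT.
- by do 2!elim/ord2P; rewrite ?connect0 //; apply: connect1; rewrite /adj_rel mxE /tbl /= oner_eq0.
- by apply/matrixP; do 2!elim/ord2P; rewrite !mxE.
- apply/matrixP; do 2!elim/ord2P; rewrite !mxE !big_ord_recl big_ord0 !mxE /tbl /= ?mulrNN ?s3_sq; ring.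
Qed.

Lemma S2dag_complete : complete_mx S2dag.
Proof.
split.
- by do 2!elim/ord2P; apply: inZs3_entry; rewrite mxE /tbl /= !inE eqxx ?orbT.
- by do 2!elim/ord2P; rewrite ?connect0 //; apply: connect1; rewrite /adj_rel mxE /tbl /= s3_neq0.
- by apply/matrixP; do 2!elim/ord2P; rewrite !mxE.
- apply/matrixP; do 2!elim/ord2P; rewrite !mxE !big_ord_recl big_ord0 !mxE /tbl /= ?mulrNN ?s3_sq; ring.
Qed.

Lemma ord4P (P : 'I_4 -> Prop) : P 0 -> P 1 -> P 2 -> P 3 -> forall i, P i.
Proof.
move=> P0 P1 P2 P3 [[|[|[|[|//]]]] Hi].
- by have -> : Ordinal Hi = 0 by apply: val_inj.
- by have -> : Ordinal Hi = 1 by apply: val_inj.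
- by have -> : Ordinal Hi = 2 by apply: val_inj.
- by have -> : Ordinal Hi = 3 by apply: val_inj.
Qed.

Lemma S4s3_complete : complete_mx S4s3.
Proof.
split.
- by do 2!elim/ord4P; apply: inZs3_entry; rewrite mxE /tbl /= !inE eqxx ?orbT.
- have e x y : S4s3 x y != 0 -> x != y -> connect (adj_rel S4s3) x y.
    by move=> Sxy xy; apply: connect1; rewrite /adj_rel xy.
  have e01 : connect (adj_rel S4s3) 0 1 by apply: e => //; rewrite mxE /tbl /= s3_neq0.
  have e10 : connect (adj_rel S4s3) 1 0 by apply: e => //; rewrite mxE /tbl /= s3_neq0.
  have e23 : connect (adj_rel S4s3) 2 3 by apply: e => //; rewrite mxE /tbl /= s3_neq0.
  have e32 : connect (adj_rel S4s3) 3 2 by apply: e => //; rewrite mxE /tbl /= s3_neq0.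
  have e02 : connect (adj_rel S4s3) 0 2 by apply: e => //; rewrite mxE /tbl /= oppr_eq0 oner_eq0.
  have e20 : connect (adj_rel S4s3) 2 0 by apply: e => //; rewrite mxE /tbl /= oppr_eq0 oner_eq0.
  have to0 : forall x, connect (adj_rel S4s3) x 0.
    by elim/ord4P => //; [exact: connect_trans e32 e20].
  have from0 : forall x, connect (adj_rel S4s3) 0 x.
    by elim/ord4P => //; [exact: connect_trans e02 e23].
  by move=> x y; apply: connect_trans (to0 x) (from0 y).
- by apply/matrixP; do 2!elim/ord4P; rewrite !mxE.
- apply/matrixP; do 2!elim/ord4P; rewrite !mxE !big_ord_recl big_ord0 !mxE /tbl /= ?mulrNN ?s3_sq; ring.
Qed.

Lemma integral_completion_mx n (A : 'M[algC]_n) (B : 'I_n -> 'I_n -> int) :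
  (forall i j, A i j = (B i j)%:~R) -> integral_completion B ->
  exists m (M : 'M[algC]_m), complete_mx M /\ principal_sub A M.
Proof.
move=> AB [U [T [F [TC Tsq Tconn Finj BT]]]].
pose M : 'M[algC]_#|U| := \matrix_(i, j) (T (enum_val i) (enum_val j))%:~R.
exists #|U|, M; split; last first.
  exists (fun i => enum_rank (F i)); split=> [i j /enum_rank_inj /Finj //|i j].
  by rewrite mxE !enum_rankK AB BT.
split.
- by move=> i j; rewrite mxE; apply: inZs3_int.
- move=> i j; have /connectP[s] := Tconn (enum_val i) (enum_val j).
  elim: s i => [|x s IH] i /=; first by move=> _ /enum_val_inj ->.
  move=> /andP[ix sx] sj; apply: (@connect_trans _ _ (enum_rank x)); last first.
    by apply: IH; rewrite enum_rankK.
  have [->|ne] := eqVneq i (enum_rank x); first exact: connect0.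
  by apply: connect1; rewrite /adj_rel ne mxE enum_rankK intr_eq0.
- by apply/matrixP => i j; rewrite !mxE TC.
- apply/matrixP => i j; rewrite !mxE.
  transitivity ((\sum_z T (enum_val i) z * T z (enum_val j))%:~R : algC).
    rewrite rmorph_sum (reindex (@enum_val U U)) /=; last exact/onW_bij/enum_val_bij.
    by apply: eq_bigr => k _; rewrite !mxE rmorphM.
  by rewrite Tsq (inj_eq enum_val_inj); case: eqP => _; rewrite ?mulr1 ?mulr0.
Qed.

(** * Integral cyclotomic matrices as signed graphs *)

Section IntegralMatrix.

Variables (n : nat) (A : 'M[algC]_n) (X : 'I_n -> 'I_n -> int).
Hypothesis AX : forall i j, A i j = (X i j)%:~R.
Hypothesis cycA : cyclotomic A.
Hypothesis indecA : indecomposable A.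

Lemma integral_AE i j : A i j = (X i j)%:~R + (0 : int)%:~R * s3.
Proof. by rewrite AX mul0r addr0. Qed.

Let wt := weight X (fun _ _ => 0).

Lemma integral_weight i j : wt i j = X i j ^+ 2.
Proof. by rewrite /wt /weight; lia. Qed.

Lemma integral_bounded_form : bounded_form X.
Proof.
move=> e y He; have He' : e%:~R = 1 :> algC \/ e%:~R = -1 :> algC.
  by case: He => ->; [left|right]; rewrite ?rmorphN.
have Hz (z : algC) : -2 <= z <= 2 -> 0 <= 2 + e%:~R * z + 0 * (z * z).
  move=> /andP[z1 z2]; rewrite mul0r addr0.
  case: He' => ->; first by rewrite mul1r -[2]opprK addrC subr_ge0.
  by rewrite mulN1r subr_ge0.
have yr i : (y i)%:~R \is @Num.real algC by rewrite Rreal_int // intr_int.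
have := cyclotomic_sum_ge0 cycA Hz yr.
suff -> : \sum_i (y i)%:~R * (\sum_j (y j)%:~R *
     (2 * (i == j)%:R + e%:~R * A i j + 0 * (\sum_k A i k * A k j)))
   = (\sum_u \sum_v y u * y v * ((u == v)%:R *+ 2 + e * X u v))%:~R :> algC by rewrite ler0z.
rewrite rmorph_sum; apply: eq_bigr => i _; rewrite rmorph_sum mulr_sumr; apply: eq_bigr => j _.
rewrite mul0r addr0 AX !rmorphM rmorphD rmorphMn rmorphM /= rmorph_nat; ring.
Qed.

Lemma integral_sym i j : X i j = X j i.
Proof. by apply: (@intr_inj algC); rewrite -!AX (cyclotomic_sym i j cycA). Qed.

(** An entry 2 or -2 fills its own row and, by symmetry, that of the other index, so i and j would
    be the whole connected graph. This happens in sizes 1 and 2 only. *)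
Lemma integral_small i j : (2 < n)%N -> X i j \in [:: 0; 1; -1].
Proof.
move=> n2; have := weight_cases integral_AE cycA i j; rewrite -/wt integral_weight => cases.
have [w4|w4] := eqVneq (wt i j) 4; last first.
  move: w4; rewrite integral_weight !inE => w4; case: cases => E.
  - have : X i j = 0 by nia.
    by move=> ->.
  - have : X i j = 1 \/ X i j = -1 by nia.
    by case=> ->.
  - by nia.
  - by rewrite E in w4.
have w4' : wt j i = 4 by rewrite integral_weight integral_sym -integral_weight.
have row p q m : wt p q = 4 -> A p m != 0 -> m = q.
  move=> w apm; apply/eqP/negPn/negP => mq; rewrite eq_sym in mq.
  have := weight2_le integral_AE cycA p mq; rewrite -/wt w.
  have := weight_ge0 X (fun _ _ => 0) p m.
  by move: apm; rewrite -(weight_eq0 integral_AE cycA) -/wt; lia.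
have all_v v : v \in [set i; j].
  move: v; apply: (@indecomposable_closed _ _ indecA _ i); first by rewrite !inE eqxx.
  move=> x y; rewrite !inE => /orP[] /eqP -> /row.
    by move/(_ _ w4) => ->; rewrite eqxx orbT.
  by move/(_ _ w4') => ->; rewrite eqxx.
have : (n <= 2)%N.
  apply: (@leq_trans #|[set i; j]|); last by rewrite cards2; case: (_ != _).
  by rewrite -[n in (n <= _)%N]card_ord; apply/subset_leq_card/subsetP => v _.
by rewrite leqNgt n2.
Qed.

Lemma integral_connected i j : connect (fun x y => X x y != 0) i j.
Proof.
have := indecA i j; apply: connect_sub => x y /andP[_ xy].
by apply: connect1; move: xy; rewrite AX intr_eq0.
Qed.

Lemma integral_degree i : (#|[set j | X i j != 0]| <= 4)%N.
Proof.
have : \sum_(j in [set j | X i j != 0]) (1 : int) <= 4.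
  apply: le_trans (weight_sum integral_AE cycA i).
  rewrite big_mkcond; apply: ler_sum => j _; rewrite inE -/wt integral_weight.
  by case: ifP; nia.
by rewrite sumr_const (ler_nat int _ 4).
Qed.

End IntegralMatrix.

Lemma Zs3_decomposition n (A : 'M[algC]_n) : Zs3_mx A ->
  exists X Y : 'I_n -> 'I_n -> int, forall i j, A i j = (X i j)%:~R + (Y i j)%:~R * s3.
Proof.
move=> AZ.
have [F HF] : exists F : 'I_n * 'I_n -> int * int, forall t,
    A t.1 t.2 = (F t).1%:~R + (F t).2%:~R * s3.
  apply: (@fin_all_exists _ (fun=> (int * int)%type)
    (fun t ab => A t.1 t.2 = ab.1%:~R + ab.2%:~R * s3)) => t.
  by have [a [b E]] := AZ t.1 t.2; exists (a, b).
by exists (fun i j => (F (i, j)).1), (fun i j => (F (i, j)).2) => i j; have := HF (i, j).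
Qed.

Lemma non_integral_sub n (A : 'M[algC]_n) : indec_cyc_Zs3 A -> ~ Z_mx A ->
  [\/ sub_signed A S2', sub_signed A S2dag | sub_signed A S4s3].
Proof.
move=> [AZ indA cycA]; have [X [Y AE]] := Zs3_decomposition AZ.
exact: non_integral_sub_signed AE cycA indA.
Qed.

(** The size bound provides both [5 ^ R < n], for the long path, and [2 < n], for entries among 0,
    1, -1. *)
Lemma large_sub_complete R : (35 <= R)%N -> forall n (A : 'M[algC]_n),
  ((5 ^ R).+2 < n)%N -> indec_cyc_Zs3 A ->
  exists m (M : 'M[algC]_m), [/\ (0 < m)%N, complete_mx M & principal_sub A M].
Proof.
move=> R35 n A nR iA; have [AZ indA cycA] := iA.
suff [m [M [cM sub]]] : exists m (M : 'M[algC]_m), complete_mx M /\ principal_sub A M.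
  exists m, M; split=> //; have [f _] := sub.
  have n0 : (0 < n)%N by apply: leq_trans nR.
  exact: leq_ltn_trans (leq0n _) (ltn_ord (f (Ordinal n0))).
have [ZA|nZ] := classic (Z_mx A); last first.
  have [sub|sub|sub] := non_integral_sub iA nZ.
  - by have [M HM] := sub_signed_complete S2'_complete sub; exists 2%N, M.
  - by have [M HM] := sub_signed_complete S2dag_complete sub; exists 2%N, M.
  - by have [M HM] := sub_signed_complete S4s3_complete sub; exists 4%N, M.
have [F HF] : exists F : 'I_n * 'I_n -> int, forall t, A t.1 t.2 = (F t)%:~R.
  apply: (@fin_all_exists _ (fun=> int) (fun t a => A t.1 t.2 = a%:~R)) => t.
  exact: ZA.
pose X i j := F (i, j); have AX i j : A i j = (X i j)%:~R := HF (i, j).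
apply: (integral_completion_mx AX); apply: (@large_completion _ _ R) => //.
- exact: integral_bounded_form AX cycA.
- exact: integral_sym AX cycA.
- by move=> u v; apply: (integral_small AX cycA indA); apply: leq_trans nR.
- exact: integral_connected AX indA.
- exact: integral_degree AX cycA.
- by rewrite card_ord; apply: leq_trans nR; rewrite ltnW.
Qed.

Lemma principal_sub_trans n m k (A : 'M[algC]_n) (B : 'M[algC]_m) (C : 'M[algC]_k) :
  principal_sub A B -> principal_sub B C -> principal_sub A C.
Proof.
move=> [f [finj fA]] [g [ginj gB]]; exists (g \o f); split; first exact: inj_comp.
by move=> i j; rewrite fA gB.
Qed.

Theorem theorem7 :
  (forall (n : nat) (A : 'M[algC]_n),
     maximal_indec_cyc_Zs3 A -> ~ Z_mx A ->
     [\/ equiv_mx A S2', equiv_mx A S2dag | equiv_mx A S4s3]) /\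
  (forall (n : nat) (A : 'M[algC]_n),
     indec_cyc_Zs3 A ->
     exists (m : nat) (B : 'M[algC]_m), maximal_indec_cyc_Zs3 B /\ principal_sub A B).
Proof.
split=> n A.
  move=> [iA maxA] nZ; have [AZ _ _] := iA.
  have same m (S : 'M[algC]_m) : (0 < m)%N -> complete_mx S -> sub_signed A S -> equiv_mx A S.
    move=> m0 cS sub; have [S' [cS' psub]] := sub_signed_complete cS sub.
    have [f [finj _]] := psub.
    (* A is a principal submatrix of the cyclotomic matrix S', so maximality leaves only equal
       sizes, where an embedding up to signs is an equivalence. *)
    have nm : (n <= m)%N by have := leq_card f finj; rewrite !card_ord.
    have {}nm : n = m.
      apply/eqP; rewrite eqn_leq nm leqNgt; apply/negP => lt; apply: maxA.
      by exists m, S'; split=> //; split=> //; apply: complete_indec_cyc.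
    by clear - AZ sub nm; move: S sub; rewrite -nm => S sub; apply: sub_signed_equiv.
  have [sub|sub|sub] := non_integral_sub iA nZ.
  - by constructor 1; apply: same S2'_complete sub.
  - by constructor 2; apply: same S2dag_complete sub.
  - by constructor 3; apply: same S4s3_complete sub.
move=> iA; apply: NNPP => no.
have grow N : exists m (B : 'M[algC]_m), [/\ (N <= m)%N, indec_cyc_Zs3 B & principal_sub A B].
  elim: N => [|N [m [B [Nm iB AB]]]].
    by exists n, A; split=> //; exists id; split.
  have [m' [C [mm' [iC BC]]]] : exists m' (C : 'M[algC]_m'),
      (m < m')%N /\ indec_cyc_Zs3 C /\ principal_sub B C.
    by apply: NNPP => maxB; apply: no; exists m, B.
  by exists m', C; split=> //; [apply: leq_ltn_trans mm'|apply: principal_sub_trans BC].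
(* R is made abstract, so that [5 ^ 35] is never evaluated in unary. *)
have [R R35] : exists R, (35 <= R)%N by exists 35%N.
have [m [B [Rm iB AB]]] := grow (5 ^ R).+3.
have [k [M [k0 cM BM]]] := large_sub_complete R35 Rm iB.
by apply: no; exists k, M; split; [apply: complete_maximal|apply: principal_sub_trans BM].
Qed.
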